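(* Let $\zeta\in L^{\infty}([0,T],\mathbb{R}^{d'})$, $\theta\in\Theta$, $\lambda>0$, and let $Q$ be a symmetric positive definite $d\times d$ matrix. Then there exists a unique pair $(\bar u_{\theta,\lambda},\widehat{x_0})\in L^2([0,T],\mathbb{R}^d)\times\mathbb{R}^d$ minimizing the cost $$C(\zeta;u,x_0,\theta,\lambda)=x_0^{T}Qx_0+\int_0^T\Big\{\|\zeta(t)-CX_{\theta,x_0,u}(t)\|_2^2+\lambda\|u(t)\|_2^2\Big\}dt .$$ The optimal control is $$\bar u_{\theta,\lambda}(t)=\frac{1}{\lambda}\Big(E_\theta(t)X_{\theta,\widehat{x_0},\bar u_{\theta,\lambda}}(t)+h_\theta(t,\zeta)\Big),$$ where $E_\theta$ and $h_\theta(\cdot,\zeta)$ solve the initial value problem $$\dot E_\theta=C^TC-A_\theta^TE_\theta-E_\theta A_\theta-\tfrac1\lambda E_\theta^2,\qquad \dot h_\theta(t,\zeta)=-\alpha_\theta(t)h_\theta(t,\zeta)-\beta_\theta(t,\zeta),$$ $(E_\theta(0),h_\theta(0,\zeta))=(Q,0)$, with $\alpha_\theta(t)=A_\theta(t)^T+\frac{1}{\lambda}E_\theta(t)$ and $\beta_\theta(t,\zeta)=C^T\zeta(t)+E_\theta(t)r_\theta(t)$. For all $t\in[0,T]$, $E_\theta(t)$ is symmetric (and $E_\theta(T)$ is nonsingular). Finally, the profiled cost $S(\zeta;\theta,\lambda)=\inf_{x_0\in\mathbb{R}^d}\inf_{u\in L^2}C(\zeta;u,x_0,\theta,\lambda)$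 has the closed form $$S(\zeta;\theta,\lambda)=\int_0^T\Big(\|\zeta(t)\|^2-2r_\theta(t)^Th_\theta(t,\zeta)-\tfrac1\lambda\|h_\theta(t,\zeta)\|^2\Big)dt-h_\theta(T,\zeta)^TE_\theta(T)^{-1}h_\theta(T,\zeta),$$ and the optimal final state is $X_{\theta,\widehat{x_0},\bar u_{\theta,\lambda}}(T)=-E_\theta(T)^{-1}h_\theta(T,\zeta)$.
   Context: Fix $T>0$, integers $d,d'\ge1$, an observation matrix $C\in\mathbb{R}^{d'\times d}$ and a parameter set $\Theta\subset\mathbb{R}^p$. For each $\theta\in\Theta$, $t\mapsto A_\theta(t)\in\mathbb{R}^{d\times d}$ and $t\mapsto r_\theta(t)\in\mathbb{R}^d$ are given (continuous) functions on $[0,T]$. For $x_0\in\mathbb{R}^d$ and a control $u\in L^2([0,T],\mathbb{R}^d)$, $X_{\theta,x_0,u}$ denotes the solution of the perturbed linear ODE $\dot x(t)=A_\theta(t)x(t)+r_\theta(t)+u(t)$, $x(0)=x_0$. $\|\cdot\|_2$ is the Euclidean norm. *)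

(* Defs.v *)
From HB Require Import structures.
From mathcomp Require Import all_boot all_order all_algebra.
From mathcomp Require Import all_classical all_reals all_analysis.
Set Implicit Arguments. Unset Strict Implicit. Unset Printing Implicit Defensive.
Import Order.TTheory GRing.Theory Num.Theory.
Import numFieldNormedType.Exports.
Local Open Scope classical_set_scope.
Local Open Scope ring_scope.

(* Vectors of R^n are column vectors 'cV[R]_n,
   matrices are 'M[R]_(m,n); time functions are defined on all of R but only
   their values on [0,T] matter.  mu is the Lebesgue measure on R. *)

Section Defs.
Variable R : realType.
Notation mu := (@lebesgue_measure R).

Definition sqn n (v : 'cV[R]_n) : R := (v^T *m v) 0 0.

Definition qform n (Q : 'M[R]_n) (x : 'cV[R]_n) : R := (x^T *m Q *m x) 0 0.

Definition sym_pos_def n (Q : 'M[R]_n) : Prop :=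
  Q^T = Q /\ forall x : 'cV[R]_n, x != 0 -> 0 < qform Q x.

Definition mxint m n (a b : R) (F : R -> 'M[R]_(m, n)) : 'M[R]_(m, n) :=
  \matrix_(i, j) Rintegral mu `[a, b] (fun s => F s i j).

Definition mxintegrable m n (D : set R) (F : R -> 'M[R]_(m, n)) : Prop :=
  forall i j, mu.-integrable D (fun s => (F s i j)%:E).

Definition mxcont_on m n (T : R) (F : R -> 'M[R]_(m, n)) : Prop :=
  forall i j, {within `[0, T], continuous (fun s => F s i j)}.

(* solution, in the (Caratheodory) integral sense on [0,T], of
   x' = G(t, x), x(0) = x0 *)
Definition ivp_sol m n (T : R) (x0 : 'M[R]_(m, n))
  (G : R -> 'M[R]_(m, n) -> 'M[R]_(m, n)) (X : R -> 'M[R]_(m, n)) : Prop :=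
  mxintegrable `[0, T] (fun s => G s (X s)) /\
  forall t, 0 <= t <= T -> X t = x0 + mxint 0 t (fun s => G s (X s)).

Definition L2 d (T : R) (u : R -> 'cV[R]_d) : Prop :=
  (forall i, measurable_fun `[0, T] (fun t => u t i 0)) /\
  (\int[mu]_(t in `[0%R, T]) (sqn (u t))%:E < +oo)%E.

Definition Linf d (T : R) (z : R -> 'cV[R]_d) : Prop :=
  (forall i, measurable_fun `[0, T] (fun t => z t i 0)) /\
  exists M : R, {ae mu, forall t, t \in `[0, T] -> sqn (z t) <= M ^+ 2}.

(* X_{theta,x0,u}: the solution of x' = A x + r + u, x(0) = x0
   (chosen by description; it exists and is unique for u in L^2) *)
Definition Xsol d (T : R) (A : R -> 'M[R]_d) (r u : R -> 'cV[R]_d)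
  (x0 : 'cV[R]_d) : R -> 'cV[R]_d :=
  get (ivp_sol T x0 (fun t x => A t *m x + r t + u t)).

Definition cost d d' (T : R) (Cm : 'M[R]_(d', d)) (Q : 'M[R]_d)
  (A : R -> 'M[R]_d) (r : R -> 'cV[R]_d) (lam : R)
  (z : R -> 'cV[R]_d') (u : R -> 'cV[R]_d) (x0 : 'cV[R]_d) : \bar R :=
  ((qform Q x0)%:E +
   \int[mu]_(t in `[0%R, T])
      (sqn (z t - Cm *m Xsol T A r u x0 t) + lam * sqn (u t))%:E)%E.

Definition profiled d d' (T : R) (Cm : 'M[R]_(d', d)) (Q : 'M[R]_d)
  (A : R -> 'M[R]_d) (r : R -> 'cV[R]_d) (lam : R)
  (z : R -> 'cV[R]_d') : \bar R :=
  ereal_inf [set ereal_inf [set cost T Cm Q A r lam z u x0 | u in L2 T]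
            | x0 in [set: 'cV[R]_d]].

End Defs.

(* Main.v *)
Require Import Defs.
From HB Require Import structures.
From mathcomp Require Import all_boot all_order all_algebra.
From mathcomp Require Import all_classical all_reals all_analysis.
From mathcomp Require Import measurable_realfun.
From mathcomp Require Import ring lra.
Import Order.TTheory GRing.Theory Num.Theory.
Import numFieldNormedType.Exports.
Local Open Scope classical_set_scope.
Local Open Scope ring_scope.
Set Implicit Arguments. Unset Strict Implicit. Unset Printing Implicit Defensive.

(* Along x' = A x + r + u, the derivative of V = x^T E x + 2 h^T x equals the
   running cost minus a function of t alone minus
   lam |u - (E x + h)/lam|^2, because E solves the Riccati equation and h its
   adjoint equation.  Since V(0) = x0^T Q x0, completing the square in x(T) gives
     cost = S + lam \int |u - (E x + h)/lam|^2
            + (x(T) + E(T)^-1 h(T))^T E(T) (x(T) + E(T)^-1 h(T)),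
   where S is the announced closed form.  The minimizer is the trajectory of the
   closed loop x' = (A + E/lam) x + r + h/lam that ends at -E(T)^-1 h(T).

   The Riccati solution exists on the whole of [0,T] because E = P Y^-1 for the
   linear Hamiltonian system Y' = A Y + P/lam, P' = C^T C Y - A^T P,
   (Y, P)(0) = (1, Q): the derivative of Y^T P is P^T P/lam + Y^T C^T C Y >= 0, so
   Y^T P >= Q > 0 and Y never becomes singular.  The same inequality, applied to
   P = E Y with Y the closed-loop fundamental matrix, shows that E(t) is positive
   definite. *)

(** * Integrals of integrable functions on [0,T] *)

Section Primitive.
Variables (R : realType) (T : R).
Hypothesis T0 : 0 < T.
Notation mu := (@lebesgue_measure R).
Implicit Types (f g F G : R -> R).

Definition int_on f := mu.-integrable `[0, T] (EFin \o f).
Definition cont_on f := {within `[0, T], continuous f}.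

(** Absolute continuity in integral form. The derivative [f] is merely integrable, as controls are
    only square integrable, so the calculus rules are stated without pointwise derivatives. *)
Definition primitive_on F f :=
  int_on f /\ forall t : R, 0 <= t <= T -> F t = F 0 + Rintegral mu `[0, t] f.

Lemma sub_0T t : t <= T -> `[0, t] `<=` `[0, T].
Proof. by move=> tT; apply: subset_itvl; rewrite bnd_simp. Qed.

Lemma int_onS t f : t <= T -> int_on f -> mu.-integrable `[0, t] (EFin \o f).
Proof. by move=> tT; apply: integrableS => //; exact: sub_0T. Qed.

Lemma int_on_eq f g : (forall t : R, 0 <= t <= T -> f t = g t) ->
  int_on f -> int_on g.
Proof.
move=> fg; apply: eq_integrable => // x; rewrite inE/= in_itv/= => /fg.
by move=> ->.
Qed.

Lemma int_on_measurable f : int_on f -> measurable_fun `[0, T] f.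
Proof. by move/measurable_int/measurable_EFinP. Qed.

Lemma int_onD f g : int_on f -> int_on g -> int_on (fun t => f t + g t).
Proof. by move=> fi gi; have := integrableD _ fi gi; apply. Qed.

Lemma int_onZ (c : R) f : int_on f -> int_on (fun t => c * f t).
Proof. by move=> fi; have := integrableZl _ c fi; apply. Qed.

Lemma int_onN f : int_on f -> int_on (fun t => - f t).
Proof. by move=> fi; have := integrableN fi; apply. Qed.

Lemma int_onB f g : int_on f -> int_on g -> int_on (fun t => f t - g t).
Proof. by move=> fi gi; apply: int_onD => //; exact: int_onN. Qed.

Lemma int_on0 : int_on (fun=> 0).
Proof. exact: integrable0. Qed.

Lemma int_on_sum (I : Type) (s : seq I) (P : pred I) (f : I -> R -> R) :
  (forall i, P i -> int_on (f i)) -> int_on (fun t => \sum_(i <- s | P i) f i t).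
Proof.
move=> fi; elim: s => [|i s IH].
  by apply: int_on_eq int_on0 => t _; rewrite big_nil.
case Pi : (P i).
  by apply: int_on_eq (int_onD (fi i Pi) IH) => t _; rewrite big_cons Pi.
by apply: int_on_eq IH => t _; rewrite big_cons Pi.
Qed.

Lemma cont_on_integrable f : cont_on f -> int_on f.
Proof. by move=> cf; apply: continuous_compact_integrable => //; exact: segment_compact. Qed.

Lemma cont_on_bounded f : cont_on f -> exists M : R, 0 < M /\ forall t : R, 0 <= t <= T -> `|f t| <= M.
Proof.
move=> cf; have /compact_bounded[M [_ HM]] := continuous_compact cf (@segment_compact _ 0 T).
exists (`|M| + 1); split; first by rewrite ltr_wpDl.
move=> t tT; apply: HM; first by rewrite ltr_pwDr// ler_norm.
by exists t => //=; rewrite in_itv.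
Qed.

Lemma int_on_contM f g : cont_on f -> int_on g -> int_on (fun t => f t * g t).
Proof.
move=> cf gi.
have [M [M0 HM]] := cont_on_bounded cf.
have := @integrableMr _ _ _ mu `[0, T] _ f _ _ _ gi; apply => //.
  exact: int_on_measurable (cont_on_integrable cf).
exists M; split; first exact: num_real.
by move=> x Mx y /=; rewrite in_itv/= => yT; rewrite (le_trans (HM _ yT))// ltW.
Qed.

Lemma cont_on_eq f g : (forall t : R, 0 <= t <= T -> f t = g t) -> cont_on f -> cont_on g.
Proof.
move=> fg; apply: subspace_eq_continuous => x; rewrite inE/= in_itv/= => xT.
exact: fg.
Qed.

Lemma cont_onD f g : cont_on f -> cont_on g -> cont_on (fun t => f t + g t).
Proof. by move=> cf cg x; apply: cvgD; [exact: cf|exact: cg]. Qed.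

Lemma cont_onM f g : cont_on f -> cont_on g -> cont_on (fun t => f t * g t).
Proof. by move=> cf cg x; apply: cvgM; [exact: cf|exact: cg]. Qed.

Lemma cont_on_cst c : cont_on (fun=> c).
Proof. by move=> x; apply: cvg_cst. Qed.

Lemma cont_on_sum (I : Type) (s : seq I) (P : pred I) (f : I -> R -> R) :
  (forall i, P i -> cont_on (f i)) -> cont_on (fun t => \sum_(i <- s | P i) f i t).
Proof.
move=> fi; elim: s => [|i s IH].
  by apply: (cont_on_eq _ (@cont_on_cst 0)) => t _; rewrite big_nil.
case Pi : (P i).
  by apply: (cont_on_eq _ (cont_onD (fi i Pi) IH)) => t _; rewrite big_cons Pi.
by apply: (cont_on_eq _ IH) => t _; rewrite big_cons Pi.
Qed.

Lemma prim_cont F f : primitive_on F f -> cont_on F.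
Proof.
move=> [fi HF].
have /= H := parameterized_integral_continuous (ltW T0) fi.
apply: (cont_on_eq _ (cont_onD (@cont_on_cst (F 0)) H)) => t /HF ->.
by [].
Qed.

Lemma eq_Rint_on t f g : t <= T -> (forall s : R, 0 <= s <= T -> f s = g s) ->
  Rintegral mu `[0, t] f = Rintegral mu `[0, t] g.
Proof.
move=> tT fg; apply: eq_Rintegral => s; rewrite inE/= in_itv/= => /andP[s0 st].
by apply: fg; rewrite s0 (le_trans st tT).
Qed.

Lemma prim_eq F f G g : (forall t : R, 0 <= t <= T -> F t = G t) ->
  (forall t : R, 0 <= t <= T -> f t = g t) ->
  primitive_on F f -> primitive_on G g.
Proof.
move=> FG fg [fi HF]; split; first exact: int_on_eq fi.
move=> t tT; have /andP[_ tT'] := tT; rewrite -FG// HF// -FG ?lexx ?ltW//.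
by rewrite (eq_Rint_on tT' fg).
Qed.

Lemma prim_cst c : primitive_on (fun=> c) (fun=> 0).
Proof.
split; first exact: int_on0.
by move=> t _; rewrite Rintegral_cst// mul0r addr0.
Qed.

Lemma primD F f G g : primitive_on F f -> primitive_on G g ->
  primitive_on (fun t => F t + G t) (fun t => f t + g t).
Proof.
move=> [fi HF] [gi HG]; split; first exact: int_onD.
move=> t /[dup] tT /andP[_ tT']; rewrite RintegralD//; try exact: int_onS.
by rewrite (HF t)// (HG t)//; ring.
Qed.

Lemma primZ c F f : primitive_on F f -> primitive_on (fun t => c * F t) (fun t => c * f t).
Proof.
move=> [fi HF]; split; first exact: int_onZ.
move=> t /[dup] tT /andP[_ tT']; rewrite RintegralZl//; last exact: int_onS.
by rewrite (HF t)//; ring.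
Qed.

Lemma prim_sum (I : Type) (s : seq I) (P : pred I) (F f : I -> R -> R) :
  (forall i, P i -> primitive_on (F i) (f i)) ->
  primitive_on (fun t => \sum_(i <- s | P i) F i t) (fun t => \sum_(i <- s | P i) f i t).
Proof.
move=> fi; elim: s => [|i s IH].
  by apply: prim_eq (prim_cst 0) => t _; rewrite big_nil.
case Pi : (P i).
  by apply: prim_eq (primD (fi i Pi) IH) => t _; rewrite big_cons Pi.
by apply: prim_eq IH => t _; rewrite big_cons Pi.
Qed.

Lemma int_prim f : int_on f -> primitive_on (fun t => Rintegral mu `[0, t] f) f.
Proof.
move=> fi; split=> // t tT.
by rewrite set_itv1 Rintegral_set1 add0r.
Qed.

End Primitive.

(** * Fubini on a triangle and the product rule *)

Section Product.
Variables (R : realType).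
Notation mu := (@lebesgue_measure R).
Implicit Types (f g F G : R -> R).

(** Both sides are the double integral of [f s * g r] over the triangle [0 <= s <= r <= t], computed
    in the two orders. *)
Lemma Fubini_triangle (t : R) f g :
  mu.-integrable `[0, t] (EFin \o f) -> mu.-integrable `[0, t] (EFin \o g) ->
  Rintegral mu `[0, t] (fun r => g r * Rintegral mu `[0, r] f) =
  Rintegral mu `[0, t] (fun s => f s * Rintegral mu `[s, t] g).
Proof.
move=> fi gi.
(* Extension by zero outside [[0, t]] allows Fubini on the whole plane; the indicator of [S] cuts
   out the triangle. *)
pose I : set R := `[0, t]%classic; pose f' := f \_ I; pose g' := g \_ I.
have mI : measurable I by exact: measurable_itv.
have fi' : mu.-integrable setT (EFin \o f').
  by rewrite /f' -restrict_EFin; by apply: (integrable_mkcond _ _).1 => //; exact: measurable_itv.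
have gi' : mu.-integrable setT (EFin \o g').
  by rewrite /g' -restrict_EFin; by apply: (integrable_mkcond _ _).1 => //; exact: measurable_itv.
have mf' := (measurable_EFinP _ _).1 (measurable_int mu fi').
have mg' := (measurable_EFinP _ _).1 (measurable_int mu gi').
pose S : set (measurableTypeR R * measurableTypeR R) := [set p | p.1 <= p.2].
have m1 := @measurable_fst _ _ (measurableTypeR R) (measurableTypeR R).
have m2 := @measurable_snd _ _ (measurableTypeR R) (measurableTypeR R).
have mS : measurable S.
  by rewrite -(setTI S); have := measurable_fun_le measurableT m1 m2; apply.
pose K (p : measurableTypeR R * measurableTypeR R) : R := f' p.1 * g' p.2 * \1_S p.
have mK : measurable_fun setT (EFin \o K).
  apply/measurable_EFinP; apply: measurable_funM; last exact: measurable_indic.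
  apply: measurable_funM.
  - by exact: (measurableT_comp mf' m1).
  - by exact: (measurableT_comp mg' m2).
(* [K] is dominated by [|f' x| * |g' y|], whose iterated integral is a product of two finite
   numbers. *)
have Ki : (mu \x mu)%E.-integrable setT (EFin \o K).
  apply/integrable12ltyP => //.
  pose c := fine (\int[mu]_y `|(g' y)%:E|)%E.
  have cE : (\int[mu]_y `|(g' y)%:E|)%E = c%:E.
    by rewrite fineK// integrable_fin_num// (integrable_abse gi').
  apply: (@le_lt_trans _ _ (\int[mu]_x (`|(f' x)%:E| * c%:E))%E).
    apply: ge0_le_integral => //.
    - by move=> x _; exact: integral_ge0.
    - have mKa : measurable_fun setT (fun p => `|(K p)%:E|%E) by exact: measurableT_comp.
      exact: (measurable_fun_fubini_tonelli_F (m2 := mu) _ mKa (fun p => abse_ge0 _)).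
    - apply: emeasurable_funM => //; apply: measurableT_comp => //.
      exact/measurable_EFinP.
    - move=> x _; rewrite -cE -ge0_integralZl//; last first.
      + by apply: measurableT_comp => //; exact/measurable_EFinP.
      apply: ge0_le_integral => //.
      + apply: measurableT_comp => //.
        exact: (measurableT_comp mK (pair1_measurable x)).
      + apply: emeasurable_funM => //; apply: measurableT_comp => //; exact/measurable_EFinP.
      + move=> y _; rewrite -!abseM -!EFinM lee_fin /K /= normrM ler_piMr//.
        by rewrite indicE; case: (_ \in _); rewrite ?normr1 ?normr0.
  under eq_integral do rewrite muleC.
  rewrite ge0_integralZl//.
  - rewrite lte_mul_pinfty//; last by case/integrableP: fi'.
    by rewrite lee_fin fine_ge0// integral_ge0.
  - by apply: measurableT_comp => //; exact/measurable_EFinP.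
  - by rewrite lee_fin fine_ge0// integral_ge0.
have := Fubini Ki => /=.
(* For fixed [x] in [I], the triangle leaves exactly [[x, t]] for the second variable. *)
rewrite [X in X = _](_ : _ = (\int[mu]_(x in I) (f x * Rintegral mu `[x, t] g)%:E)%E); last first.
  rewrite [RHS]integral_mkcond; apply: eq_integral => x _.
  rewrite patchE; case: ifPn => xI; last first.
    rewrite integral0_eq// => y _.
    by rewrite /K /f' patchE (negbTE xI) !mul0r.
  move: (xI); rewrite inE /I/= in_itv/= => /andP[x0 xt].
  have gxt : mu.-integrable `[x, t] (EFin \o g).
    by apply: integrableS gi => //; apply: subset_itvr; rewrite bnd_simp.
  rewrite EFinM /Rintegral fineK; last exact: integrable_fin_num.
  rewrite -integralZl// integral_mkcond; apply: eq_integral => y _.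
  rewrite /K /= /f' patchE xI -!mulrA EFinM patchE.
  case: ifPn => [|/negP]; rewrite inE/= in_itv/= => yxt.
    move/andP: yxt => [xy yt].
    rewrite /g' patchE mem_set/=; last by rewrite /I/= in_itv/= yt (le_trans x0 xy).
    by rewrite indicE mem_set// mulr1.
  rewrite /g' patchE; case: ifPn; last by rewrite mul0r mule0.
  rewrite inE /I/= in_itv/= => /andP[y0 yt]; rewrite indicE memNset ?mulr0 ?mule0//.
  by move=> /= xy; apply: yxt; rewrite xy yt.
rewrite [X in _ = X](_ : _ = (\int[mu]_(y in I) (g y * Rintegral mu `[0, y] f)%:E)%E); last first.
  rewrite [RHS]integral_mkcond; apply: eq_integral => y _.
  rewrite patchE; case: ifPn => yI; last first.
    rewrite integral0_eq// => x _.
    by rewrite /K /g' /= patchE (negbTE yI) mulr0 mul0r.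
  move: (yI); rewrite inE /I/= in_itv/= => /andP[y0 yt].
  have fy : mu.-integrable `[0, y] (EFin \o f).
    by apply: integrableS fi => //; apply: subset_itvl; rewrite bnd_simp.
  rewrite EFinM /Rintegral fineK; last exact: integrable_fin_num.
  rewrite -integralZl// integral_mkcond; apply: eq_integral => x _.
  rewrite /K /= (mulrC (f' x)) -!mulrA /g' patchE yI EFinM patchE.
  case: ifPn => [|/negP]; rewrite inE/= in_itv/= => yxt.
    move/andP: yxt => [x0 xy].
    rewrite /f' patchE mem_set/=; last by rewrite /I/= in_itv/= x0 (le_trans xy yt).
    by rewrite indicE mem_set// mulr1.
  rewrite /f' patchE; case: ifPn; last by rewrite mul0r mule0.
  rewrite inE /I/= in_itv/= => /andP[x0 xt]; rewrite indicE memNset ?mulr0 ?mule0//.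
  by move=> /= xy; apply: yxt; rewrite xy x0.
by move=> H; rewrite /Rintegral -H.
Qed.

Variable T : R.
Hypothesis T0 : 0 < T.

(** Integration by parts: with [G s = G t - \int_s^t g] and [F s = F 0 + \int_0^s f], the two double
    integrals that appear cancel by [Fubini_triangle]. *)
Lemma primM F f G g : primitive_on T F f -> primitive_on T G g ->
  primitive_on T (fun t => F t * G t) (fun t => f t * G t + F t * g t).
Proof.
move=> Ff Gg; have [fi HF] := Ff; have [gi HG] := Gg.
have cF := prim_cont T0 Ff; have cG := prim_cont T0 Gg.
have fGi : int_on T (fun t => f t * G t).
  by apply: int_on_eq (int_on_contM cG fi) => t _; rewrite mulrC.
have Fgi : int_on T (fun t => F t * g t) by exact: int_on_contM.
split; first exact: int_onD.
move=> t /[dup] tT /andP[t0 tT'].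
have cf0 := prim_cont T0 (int_prim fi); have cg0 := prim_cont T0 (int_prim gi).
rewrite RintegralD//; [|exact: (int_onS tT' fGi)|exact: (int_onS tT' Fgi)].
have fit := int_onS tT' fi; have git := int_onS tT' gi.
have E1 : Rintegral mu `[0, t] (fun s => f s * G s) =
    G t * Rintegral mu `[0, t] f - Rintegral mu `[0, t] (fun s => f s * Rintegral mu `[s, t] g).
  rewrite -RintegralZl// -RintegralB//.
  - apply: eq_Rintegral => s; rewrite inE/= in_itv/= => /andP[s0 st].
    have sT : 0 <= s <= T by rewrite s0 (le_trans st).
    rewrite (HG s)// (HG t)//.
    rewrite -(@Rintegral_itv_obnd_cbnd _ s (BRight t)); last first.
      apply: integrableS git => //.
      by apply: subset_itvr; rewrite bnd_simp.
    rewrite -(@Rintegral_itvB _ _ (BLeft 0) (BRight t))//; first by ring.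
  - exact: int_onS (int_onZ (G t) fi).
  (* The integral of [g] over [[s, t]] is [G t - G s], so integrability reduces to products with
     continuous functions. *)
  - have H : int_on T (fun s => f s * (G t - G s)).
      apply: (int_on_eq (f := fun s => G t * f s - f s * G s)).
        by move=> s _; ring.
      by apply: int_onB => //; exact: int_onZ.
    apply: eq_integrable (int_onS tT' H) => // s; rewrite inE/= in_itv/= => /andP[s0 st].
    have sT : 0 <= s <= T by rewrite s0 (le_trans st).
    rewrite /= (HG s)// (HG t)//.
    rewrite -(@Rintegral_itv_obnd_cbnd _ s (BRight t)); last first.
      apply: integrableS git => //.
      by apply: subset_itvr; rewrite bnd_simp.
    rewrite -(@Rintegral_itvB _ _ (BLeft 0) (BRight t))//; congr (_%:E); ring.
have E2 : Rintegral mu `[0, t] (fun s => F s * g s) =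
    F 0 * Rintegral mu `[0, t] g + Rintegral mu `[0, t] (fun s => g s * Rintegral mu `[0, s] f).
  rewrite -RintegralZl// -RintegralD//.
  - apply: (eq_Rint_on tT') => s sT.
    rewrite (HF s)//; ring.
  - exact: int_onS (int_onZ (F 0) gi).
  - apply: (int_onS tT').
    by apply: int_on_eq (int_on_contM cf0 gi) => s _; rewrite mulrC.
rewrite E1 E2 (Fubini_triangle fit git) (HF t)// (HG t)//.
ring.
Qed.

End Product.

(** * Exponentially weighted integral bounds *)

Section Weight.
Variables (R : realType).
Notation mu := (@lebesgue_measure R).

(** Fundamental theorem of calculus for [c^-1 * expR (c * s)]; the degenerate interval [t = 0] is
    treated apart. *)
Lemma Rintegral_expR (c t : R) : 0 < c -> 0 <= t ->
  Rintegral mu `[0, t] (fun s => expR (c * s)) = (expR (c * t) - 1) / c.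
Proof.
move=> c0; rewrite le_eqVlt => /predU1P[<-|t0].
  by rewrite set_itv1 Rintegral_set1 mulr0 expR0 subrr mul0r.
pose F s : R := c^-1 * expR (c * s).
have dF (x : R) : is_derive x 1 F (expR (c * x)).
  rewrite /F.
  have -> : expR (c * x) = c^-1 *: (c *: expR (c * x)).
    by rewrite scalerA mulVf ?scale1r// gt_eqF.
  apply: is_deriveZ.
  have H : is_derive x (1 : R) ( *%R c) c.
    by have := @is_deriveZ R R R id c x 1 1 (@is_derive_id _ _ _ _); rewrite /GRing.scale/= mulr1.
  have := @is_derive1_comp R expR _ x _ c (is_derive_expR (c * x)) H.
  by rewrite mulrC; apply.
have cF : continuous F.
  move=> x; apply: differentiable_continuous; apply/derivable1_diffP.
  by case: (dF x).
have ce : continuous (fun s : R => expR (c * s)).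
  move=> x; apply: continuous_comp; last exact: continuous_expR.
  by apply: cvgM => //; exact: cvg_cst.
rewrite /Rintegral (@continuous_FTC2 R _ F) //=.
- rewrite /F mulr0 expR0; ring.
- exact: continuous_subspaceT.
- split.
  + by move=> x _; case: (dF x).
  + exact: cvg_at_right_filter (cF 0).
  + exact: cvg_at_left_filter (cF t).
- by move=> x _; rewrite derive1E; case: (dF x).
Qed.

(* The weight [expR (2 c s)] turns the integral bound into a contraction of ratio 1/2. *)
Lemma Rintegral_expR_bound (T : R) (h : R -> R) (c b : R) : 0 < c -> 0 <= b ->
  int_on T h ->
  (forall s : R, 0 <= s <= T -> `|h s| <= c * b * expR (2 * c * s)) ->
  forall t : R, 0 <= t <= T -> `|Rintegral mu `[0, t] h| <= b / 2 * expR (2 * c * t).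
Proof.
move=> c0 b0 hi hb t /andP[t0 tT].
have hit := int_onS tT hi.
apply: (le_trans (le_normr_Rintegral _ hit)) => //.
have ei : mu.-integrable `[0, t] (EFin \o (fun s => expR (2 * c * s))).
  apply: (@cont_on_integrable _ t); apply: continuous_subspaceT => x.
  apply: continuous_comp; last exact: continuous_expR.
  by apply: cvgM => //; exact: cvg_cst.
apply: (@le_trans _ _ (Rintegral mu `[0, t] (fun s => c * b * expR (2 * c * s)))).
  apply: le_Rintegral => //.
  - exact: integrable_norm.
  - have := @int_onZ _ t (c * b) _ ei; exact.
  - move=> s /=; rewrite in_itv/= => /andP[s0 st]; apply: hb.
    by rewrite s0 (le_trans st).
rewrite RintegralZl// Rintegral_expR ?mulr_gt0//.
(* The rate [2 * c] yields the factor [b / 2]; the lower endpoint contributes [- b / 2], which is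
   dropped. *)
have -> : c * b * ((expR (2 * c * t) - 1) / (2 * c)) = b / 2 * expR (2 * c * t) - b / 2.
  by field; rewrite gt_eqF.
by rewrite gerBl divr_ge0.
Qed.

End Weight.
(** * Matrix-valued primitives and linear differential equations *)

Section MatrixPrimitive.
Variables (R : realType) (T : R).
Hypothesis T0 : 0 < T.
Notation mu := (@lebesgue_measure R).

Definition mprim m n (F f : R -> 'M[R]_(m, n)) : Prop :=
  forall i j, primitive_on T (fun t => F t i j) (fun t => f t i j).

Notation mint F := (mxintegrable (`[0, T]%classic : set R) F).
Notation mcont F := (mxcont_on T F).

Lemma mxcont_eq m n (F G : R -> 'M[R]_(m, n)) :
  (forall t : R, 0 <= t <= T -> F t = G t) -> mcont F -> mcont G.
Proof.
move=> FG cF i j; apply: (@cont_on_eq _ T (fun t => F t i j)); last exact: cF.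
by move=> t tT; rewrite FG.
Qed.

Lemma mxcont_cst m n (C : 'M[R]_(m, n)) : mcont (fun=> C).
Proof. by move=> i j; exact: cont_on_cst. Qed.

Lemma mxcontD m n (F G : R -> 'M[R]_(m, n)) : mcont F -> mcont G ->
  mcont (fun t => F t + G t).
Proof.
move=> cF cG i j.
by apply: (cont_on_eq _ (cont_onD (cF i j) (cG i j))) => t _; rewrite mxE.
Qed.

Lemma mxcontZ m n (c : R) (F : R -> 'M[R]_(m, n)) : mcont F -> mcont (fun t => c *: F t).
Proof.
move=> cF i j.
by apply: (cont_on_eq _ (cont_onM (@cont_on_cst _ _ c) (cF i j))) => t _; rewrite mxE.
Qed.

Lemma mxcontN m n (F : R -> 'M[R]_(m, n)) : mcont F -> mcont (fun t => - F t).
Proof.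
move=> cF; apply: (mxcont_eq _ (@mxcontZ _ _ (-1) _ cF)) => t _.
by rewrite scaleN1r.
Qed.

Lemma mxcontB m n (F G : R -> 'M[R]_(m, n)) : mcont F -> mcont G ->
  mcont (fun t => F t - G t).
Proof. by move=> cF cG; exact: mxcontD cF (mxcontN cG). Qed.

Lemma mxcontT m n (F : R -> 'M[R]_(m, n)) : mcont F -> mcont (fun t => (F t)^T).
Proof. by move=> cF i j; apply: (cont_on_eq _ (cF j i)) => t _; rewrite mxE. Qed.

Lemma mxcontM m n p (F : R -> 'M[R]_(m, n)) (G : R -> 'M[R]_(n, p)) :
  mcont F -> mcont G -> mcont (fun t => F t *m G t).
Proof.
move=> cF cG i j.
have H : cont_on T (fun t => \sum_k F t i k * G t k j).
  by apply: cont_on_sum => k _; apply: cont_onM; [exact: cF|exact: cG].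
by apply: (cont_on_eq _ H) => t _; rewrite mxE.
Qed.

Lemma mxcont_bounded m n (F : R -> 'M[R]_(m, n)) : mcont F ->
  exists M : R, 0 < M /\ forall t : R, 0 <= t <= T -> forall i j, `|F t i j| <= M.
Proof.
move=> cF.
have /choice[B HB] (ij : 'I_m * 'I_n) : exists M : R, 0 < M /\
    forall t : R, 0 <= t <= T -> `|F t ij.1 ij.2| <= M.
  exact: (cont_on_bounded (cF ij.1 ij.2)).
(* The summand [1] keeps the bound positive even for matrices without entries. *)
exists (1 + \sum_ij B ij); split.
  by rewrite ltr_pwDl// sumr_ge0// => ij _; exact/ltW/(HB ij).1.
move=> t tT i j; rewrite (le_trans ((HB (i, j)).2 t tT))//.
rewrite (bigD1 (i, j))//= addrCA lerDl addr_ge0// sumr_ge0// => ij _.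
exact/ltW/(HB ij).1.
Qed.

Lemma mxintegrable_eq m n (F G : R -> 'M[R]_(m, n)) :
  (forall t : R, 0 <= t <= T -> F t = G t) -> mint F -> mint G.
Proof.
move=> FG iF i j; apply: (@int_on_eq _ T (fun t => F t i j)); last exact: iF.
by move=> t tT; rewrite FG.
Qed.

Lemma mxintegrableD m n (F G : R -> 'M[R]_(m, n)) : mint F -> mint G ->
  mint (fun t => F t + G t).
Proof.
move=> cF cG i j.
by apply: (int_on_eq _ (int_onD (cF i j) (cG i j))) => t _; rewrite mxE.
Qed.

Lemma mxintegrableZ m n (c : R) (F : R -> 'M[R]_(m, n)) : mint F -> mint (fun t => c *: F t).
Proof.
move=> cF i j.
by apply: (int_on_eq _ (int_onZ c (cF i j))) => t _; rewrite mxE.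
Qed.

Lemma mxintegrableN m n (F : R -> 'M[R]_(m, n)) : mint F -> mint (fun t => - F t).
Proof.
move=> cF; apply: (mxintegrable_eq _ (mxintegrableZ (-1) cF)) => t _.
by rewrite scaleN1r.
Qed.

Lemma mxcont_integrable m n (F : R -> 'M[R]_(m, n)) : mcont F -> mint F.
Proof. by move=> cF i j; exact: (cont_on_integrable (cF i j)). Qed.

Lemma mxintegrable_contM m n p (F : R -> 'M[R]_(m, n)) (G : R -> 'M[R]_(n, p)) :
  mcont F -> mint G -> mint (fun t => F t *m G t).
Proof.
move=> cF cG i j.
have H : int_on T (fun t => \sum_k F t i k * G t k j).
  by apply: int_on_sum => k _; apply: int_on_contM; [exact: cF|exact: cG].
by apply: (int_on_eq _ H) => t _; rewrite mxE.
Qed.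

Lemma mprim_eq m n (F f G g : R -> 'M[R]_(m, n)) :
  (forall t : R, 0 <= t <= T -> F t = G t) ->
  (forall t : R, 0 <= t <= T -> f t = g t) -> mprim F f -> mprim G g.
Proof.
move=> FG fg Ff i j; apply: (prim_eq T0 _ _ (Ff i j)) => t tT.
  by rewrite FG.
by rewrite fg.
Qed.

Lemma mprim_cont m n (F f : R -> 'M[R]_(m, n)) : mprim F f -> mcont F.
Proof. by move=> Ff i j; exact: prim_cont (Ff i j). Qed.

Lemma mprim_integrable m n (F f : R -> 'M[R]_(m, n)) : mprim F f -> mint f.
Proof. by move=> Ff i j; exact: (Ff i j).1. Qed.

Lemma mprimD m n (F f G g : R -> 'M[R]_(m, n)) : mprim F f -> mprim G g ->
  mprim (fun t => F t + G t) (fun t => f t + g t).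
Proof.
by move=> Ff Gg i j; apply: (prim_eq T0 _ _ (primD (Ff i j) (Gg i j))) => t _; rewrite mxE.
Qed.

Lemma mprimZ m n c (F f : R -> 'M[R]_(m, n)) : mprim F f ->
  mprim (fun t => c *: F t) (fun t => c *: f t).
Proof. by move=> Ff i j; apply: (prim_eq T0 _ _ (primZ c (Ff i j))) => t _; rewrite mxE. Qed.

Lemma mprimB m n (F f G g : R -> 'M[R]_(m, n)) : mprim F f -> mprim G g ->
  mprim (fun t => F t - G t) (fun t => f t - g t).
Proof.
move=> Ff Gg; apply: (mprim_eq _ _ (mprimD Ff (mprimZ (-1) Gg))) => t _;
  by rewrite scaleN1r.
Qed.

Lemma mprimT m n (F f : R -> 'M[R]_(m, n)) : mprim F f ->
  mprim (fun t => (F t)^T) (fun t => (f t)^T).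
Proof. by move=> Ff i j; apply: (prim_eq T0 _ _ (Ff j i)) => t _; rewrite mxE. Qed.

Lemma mprim_cst m n (C : 'M[R]_(m, n)) : mprim (fun=> C) (fun=> 0).
Proof. by move=> i j; apply: (prim_eq T0 _ _ (prim_cst T (C i j))) => t _; rewrite ?mxE. Qed.

Lemma mprimM m n p (F f : R -> 'M[R]_(m, n)) (G g : R -> 'M[R]_(n, p)) :
  mprim F f -> mprim G g ->
  mprim (fun t => F t *m G t) (fun t => f t *m G t + F t *m g t).
Proof.
move=> Ff Gg i j.
have H := prim_sum T0 (index_enum 'I_n) (P := xpredT)
  (fun k _ => primM T0 (Ff i k) (Gg k j)).
apply: (prim_eq T0 _ _ H) => t _; rewrite !mxE//.
by rewrite big_split.
Qed.

Lemma mprim_mxint m n (f : R -> 'M[R]_(m, n)) : mint f -> mprim (fun t => mxint 0 t f) f.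
Proof.
move=> fi i j; apply: (prim_eq T0 _ _ (int_prim (fi i j))) => t _ //.
by rewrite mxE.
Qed.

Lemma mprimE m n (F f : R -> 'M[R]_(m, n)) t : mprim F f -> 0 <= t <= T ->
  F t = F 0 + mxint 0 t f.
Proof.
by move=> Ff tT; apply/matrixP => i j; rewrite !mxE; exact: (Ff i j).2.
Qed.

Lemma mprim_const m n (F f : R -> 'M[R]_(m, n)) : mprim F f ->
  (forall t : R, 0 <= t <= T -> f t = 0) -> forall t : R, 0 <= t <= T -> F t = F 0.
Proof.
move=> Ff f0 t tT; apply/matrixP => i j.
have H : primitive_on T (fun t => F t i j) (fun=> 0).
  by apply: (prim_eq T0 _ _ (Ff i j)) => s sT //; rewrite f0// mxE.
by rewrite H.2// Rintegral_cst// mul0r addr0.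
Qed.

(** At [t = 0] the integral is over a single point, so the integral equation itself fixes [X 0]. *)
Lemma ivp_solP m n (x0 : 'M[R]_(m, n)) G X :
  ivp_sol T x0 G X <-> X 0 = x0 /\ mprim X (fun s => G s (X s)).
Proof.
split=> [[Gi HX]|[X0 HX]].
  have H0 : X 0 = x0.
    rewrite HX ?lexx ?ltW//; apply/matrixP => i j.
    by rewrite !mxE set_itv1 Rintegral_set1 addr0.
  split=> // i j; split; first exact: Gi.
  by move=> t tT; rewrite HX// -H0 !mxE.
split; first exact: mprim_integrable HX.
by move=> t tT; rewrite -X0; exact: mprimE.
Qed.

End MatrixPrimitive.

(** * Uniqueness and existence for linear differential equations *)

Section LinearODE.
Variables (R : realType) (T : R).
Hypothesis T0 : 0 < T.
Notation mu := (@lebesgue_measure R).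
Notation mint F := (mxintegrable (`[0, T]%classic : set R) F).
Notation mcont F := (mxcont_on T F).

Lemma geometric_bound_eq0 (x C : R) : (forall k, `|x| <= C * 2^-1 ^+ k) -> x = 0.
Proof.
move=> H; apply/eqP; rewrite -normr_le0.
have h2 : `|2^-1 : R| < 1 by rewrite ger0_norm// invf_lt1// ltr1n.
have /cvg_lim <-// := @cvg_geometric R C _ h2.
apply: limr_ge; first by apply/cvg_ex; exists 0; exact: cvg_geometric.
exact: nearW.
Qed.

(** Each pass through the integral equation halves the bound relative to the weight
    [expR (2 * c * t)], so the entries of [D] are below [B * 2^-1 ^+ k] times the weight for every
    [k]. *)
Lemma gronwall_eq0 m n (D H : R -> 'M[R]_(m, n)) (c : R) : 0 < c ->
  mprim T D H -> D 0 = 0 ->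
  (forall s b : R, 0 <= s <= T -> 0 <= b -> (forall k l, `|D s k l| <= b) ->
     forall i j, `|H s i j| <= c * b) ->
  forall t : R, 0 <= t <= T -> D t = 0.
Proof.
move=> c0 DH D0 Hb.
have [B [B0 HB]] := mxcont_bounded (mprim_cont T0 DH).
have key k : forall t : R, 0 <= t <= T -> forall i j,
    `|D t i j| <= B * 2^-1 ^+ k * expR (2 * c * t).
  elim: k => [|k IH] t tT i j.
    rewrite expr0 mulr1 (le_trans (HB t tT i j))// ler_peMr ?(ltW B0)//.
    by have [t0 _] := andP tT; rewrite leNgt expR_lt1 -leNgt !mulr_ge0 // ltW.
  have [Hi HD] := DH i j; rewrite HD// D0 mxE add0r.
  have -> : B * 2^-1 ^+ k.+1 = (B * 2^-1 ^+ k) / 2 by rewrite exprSr mulrA.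
  apply: (Rintegral_expR_bound c0 _ Hi _ tT).
    by rewrite mulr_ge0 ?exprn_ge0// ltW.
  move=> s sT; rewrite -(mulrA c); apply: Hb => //; last by move=> *; exact: IH.
  by rewrite !mulr_ge0 ?exprn_ge0 ?expR_ge0// ltW.
move=> t tT; apply/matrixP => i j; rewrite mxE.
apply: (@geometric_bound_eq0 _ (B * expR (2 * c * t))) => k.
by rewrite mulrAC; exact: key.
Qed.

(** The factor [n.+1] in place of [n] keeps the constants built from it positive when [n = 0]. *)
Lemma mulmx_entry_bound m n p (A : 'M[R]_(m, n)) (B : 'M[R]_(n, p)) (a b : R) :
  0 <= a -> 0 <= b ->
  (forall i k, `|A i k| <= a) -> (forall k j, `|B k j| <= b) ->
  forall i j, `|(A *m B) i j| <= n.+1%:R * a * b.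
Proof.
move=> a0 b0 HA HB i j; rewrite mxE (le_trans (ler_norm_sum _ _ _))//.
apply: (@le_trans _ _ (\sum_(k < n) a * b)).
  by apply: ler_sum => k _; rewrite normrM ler_pM.
rewrite sumr_const card_ord -[leLHS]mulr_natl -mulrA ler_wpM2r ?mulr_ge0//.
by rewrite ler_nat.
Qed.

(** Coefficients on both sides are allowed because the difference between a Riccati solution and its
    transpose satisfies such an equation. *)
Lemma linear_ode_eq0 m n (M1 : R -> 'M[R]_m) (M2 : R -> 'M[R]_n) (D H : R -> 'M[R]_(m, n)) :
  mcont M1 -> mcont M2 -> mprim T D H ->
  (forall t : R, 0 <= t <= T -> H t = M1 t *m D t + D t *m M2 t) ->
  D 0 = 0 -> forall t : R, 0 <= t <= T -> D t = 0.
Proof.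
move=> c1 c2 DH HE D0.
have [K1 [K10 HK1]] := mxcont_bounded c1.
have [K2 [K20 HK2]] := mxcont_bounded c2.
apply: (@gronwall_eq0 _ _ D H (m.+1%:R * K1 + n.+1%:R * K2)) => //.
  by rewrite addr_gt0// mulr_gt0.
move=> s b sT b0 Hb i j; rewrite HE// mxE mulrDl (le_trans (ler_normD _ _))//.
apply: lerD.
  by apply: mulmx_entry_bound => //; [exact: ltW|exact: HK1].
rewrite mulrAC; apply: mulmx_entry_bound => //; first exact: ltW.
exact: HK2.
Qed.

Section Picard.
Variables (m n : nat) (M : R -> 'M[R]_m) (g : R -> 'M[R]_(m, n)) (x0 : 'M[R]_(m, n)).
Hypotheses (cM : mcont M) (ig : mint g).

Let F t := x0 + mxint 0 t g.

(** Successive approximations for [X' = M X + g]. The source enters only through the continuous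
    function [F], so every iterate is continuous. *)
Fixpoint picard (k : nat) : R -> 'M[R]_(m, n) :=
  if k is k'.+1 then fun t => F t + mxint 0 t (fun s => M s *m picard k' s) else F.

Let cF : mcont F.
Proof.
exact: (mxcontD (@mxcont_cst _ _ _ _ x0) (mprim_cont T0 (mprim_mxint T0 ig))).
Qed.

Let cP k : mcont (picard k).
Proof.
elim: k => [|k IH]; first exact: cF.
apply: (mxcontD cF).
exact: (mprim_cont T0 (mprim_mxint T0 (mxcont_integrable (mxcontM cM IH)))).
Qed.

Let D k t := picard k.+1 t - picard k t.

Let D_entry k (t : R) i j : D k t i j = picard k.+1 t i j - picard k t i j.
Proof. by rewrite [LHS]mxE [X in _ + X]mxE. Qed.

Let picardS k (t : R) : picard k.+1 t = F t + mxint 0 t (fun s => M s *m picard k s).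
Proof. by []. Qed.

(** The common term [F] cancels. *)
Let D_step k (t : R) : 0 <= t <= T -> D k.+1 t = mxint 0 t (fun s => M s *m D k s).
Proof.
move=> /andP[t0 tT].
rewrite [LHS]/D (picardS k.+1 t) (picardS k t) opprD addrACA subrr add0r.
apply/matrixP => i j; rewrite [LHS]mxE [X in _ + X]mxE ![mxint _ _ _ i j]mxE.
rewrite -RintegralB//.
- by apply: (eq_Rint_on tT) => s _; rewrite /D mulmxBr [RHS]mxE [X in _ = _ + X]mxE.
- exact: (int_onS tT (mxcont_integrable (mxcontM cM (@cP k.+1)) i j)).
- exact: (int_onS tT (mxcont_integrable (mxcontM cM (@cP k)) i j)).
Qed.

(** The weighted contraction of ratio 1/2 applies to [D_step]; the weight is then bounded by its
    value at [T]. *)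
Let D_bound : exists B : R, 0 < B /\ forall k (t : R), 0 <= t <= T -> forall i j,
  `|D k t i j| <= B * 2^-1 ^+ k.
Proof.
have [K [K0 HK]] := mxcont_bounded cM.
have [B [B0 HB]] := mxcont_bounded (mxcontB (@cP 1) (@cP 0)).
pose c : R := m.+1%:R * K.
have c0 : 0 < c by rewrite mulr_gt0.
exists (B * expR (2 * c * T)); split; first by rewrite mulr_gt0// expR_gt0.
have key k : forall t : R, 0 <= t <= T -> forall i j,
    `|D k t i j| <= B * 2^-1 ^+ k * expR (2 * c * t).
  elim: k => [|k IH] t tT i j.
    rewrite expr0 mulr1 (le_trans (HB t tT i j))// ler_peMr ?(ltW B0)//.
    by have [t0 _] := andP tT; rewrite leNgt expR_lt1 -leNgt !mulr_ge0 // ltW.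
  rewrite D_step// mxE.
  have -> : B * 2^-1 ^+ k.+1 = (B * 2^-1 ^+ k) / 2 by rewrite exprSr mulrA.
  apply: (Rintegral_expR_bound c0 _ _ _ tT).
  - by rewrite mulr_ge0 ?exprn_ge0// ltW.
  - exact: (mxcont_integrable (mxcontM cM (mxcontB (@cP k.+1) (@cP k))) i j).
  - move=> s sT; rewrite -(mulrA c); apply: mulmx_entry_bound => //.
    + exact: ltW.
    + by rewrite !mulr_ge0 ?exprn_ge0 ?expR_ge0// ltW.
    + exact: HK.
    + exact: IH.
move=> k t tT i j; rewrite (le_trans (key k t tT i j))// mulrAC.
rewrite ler_wpM2r ?exprn_ge0// ler_wpM2l ?(ltW B0)// ler_expR ler_wpM2l//.
  by rewrite mulr_ge0// ltW.
by case/andP: tT.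
Qed.

(** Meaningful for [t] in [[0, T]], where [picard_cvg] shows convergence. *)
Definition picard_lim t : 'M[R]_(m, n) := \matrix_(i, j) limn (fun k => picard k t i j).

(** The iterates are partial sums of a telescoping series dominated by a geometric one. *)
Let picard_cvg (t : R) i j : 0 <= t <= T ->
  picard k t i j @[k --> \oo] --> picard_lim t i j.
Proof.
move=> tT; rewrite /picard_lim mxE.
have [B [B0 HB]] := D_bound.
have h2 : `|2^-1 : R| < 1 by rewrite ger0_norm// invf_lt1// ltr1n.
suff : cvgn (fun k => picard k t i j) by [].
have -> : (fun k => picard k t i j) =
    (fun k => picard 0 t i j + series (telescope (fun k => picard k t i j)) k).
  by apply/funext => k; rewrite -eq_sum_telescope.
apply: is_cvgD; first exact: is_cvg_cst.
apply: normed_cvg.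
apply: (@series_le_cvg _ _ (geometric B 2^-1)).
- by move=> k; exact: normr_ge0.
- by move=> k; rewrite geometric_ge0// ltW.
- by move=> k; have := HB k t tT i j; rewrite D_entry; exact.
- exact: is_cvg_geometric_series.
Qed.

Let picard_bounded : exists C : R, 0 < C /\ forall k (t : R), 0 <= t <= T -> forall i j,
  `|picard k t i j| <= C.
Proof.
have [B [B0 HB]] := D_bound.
have [B' [B'0 HB']] := mxcont_bounded cF.
exists (B' + 2 * B); split; first by rewrite addr_gt0// mulr_gt0.
(* [2 * B * (1 - 2^-1 ^+ k)] is the sum of the first [k] increment bounds [B * 2^-1 ^+ l]. *)
have key k (t : R) : 0 <= t <= T -> forall i j,
    `|picard k t i j| <= B' + 2 * B * (1 - 2^-1 ^+ k).
  move=> tT i j; elim: k => [|k IH]; first by rewrite expr0 subrr mulr0 addr0 HB'.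
  have -> : picard k.+1 t i j = picard k t i j + D k t i j.
    by rewrite D_entry addrC subrK.
  rewrite (le_trans (ler_normD _ _))//.
  have := HB k t tT i j; rewrite exprS; move: IH.
  set x := `|_|; set y := `|_|; set e := 2^-1 ^+ k => h1 h2.
  have -> : B' + 2 * B * (1 - 2^-1 * e) = B' + 2 * B * (1 - e) + B * e by field.
  exact: lerD.
move=> k t tT i j; rewrite (le_trans (key k t tT i j))// lerD2l.
by rewrite ler_piMr ?mulr_ge0 ?ltW// gerBl exprn_ge0.
Qed.

Let lim_bounded : exists C : R, 0 < C /\ forall t : R, 0 <= t <= T -> forall i j,
  `|picard_lim t i j| <= C.
Proof.
have [C [C0 HC]] := picard_bounded; exists C; split=> // t tT i j.
have /cvg_norm h := @picard_cvg t i j tT.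
by apply: (ler_cvg_to h (cvg_cst C)); apply: nearW => k; exact: HC.
Qed.

(** A pointwise limit of measurable functions is measurable, and a bounded one is integrable on an
    interval of finite length. *)
Let lim_int : mint picard_lim.
Proof.
move=> i j; have [C [C0 HC]] := lim_bounded.
apply: measurable_bounded_integrable => //.
- by have := @lebesgue_measure_itv R `[0, T] => /= ->; case: ifPn => _; rewrite ltry.
- apply: (@measurable_fun_cvg _ _ _ _ (fun k t => picard k t i j)).
  + by move=> k; exact: int_on_measurable (mxcont_integrable (@cP k) i j).
  + by move=> t /=; rewrite in_itv/=; exact: picard_cvg.
- exists C; split; first exact: num_real.
  move=> x Cx t /=; rewrite in_itv/= => tT; exact: le_trans (HC t tT i j) (ltW Cx).
Qed.

(** Dominated convergence in the recursion, with a constant dominating function obtained from the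
    uniform bounds on [M] and on the iterates. *)
Let picard_limE (t : R) : 0 <= t <= T ->
  picard_lim t = F t + mxint 0 t (fun s => M s *m picard_lim s).
Proof.
move=> /[dup] tT /andP[t0 tT']; apply/matrixP => i j.
have [K [K0 HK]] := mxcont_bounded cM.
have [C [C0 HC]] := picard_bounded.
have h1 : picard k.+1 t i j @[k --> \oo] --> picard_lim t i j.
  by have := @picard_cvg t i j tT; rewrite -(cvg_shiftn 1); under eq_fun do rewrite addn1.
have iML := int_onS tT' (mxintegrable_contM cM lim_int i j).
suff h2 : picard k.+1 t i j @[k --> \oo] -->
    (F t + mxint 0 t (fun s => M s *m picard_lim s)) i j.
  by rewrite -(cvg_lim _ h1)// -(cvg_lim _ h2).
rewrite !mxE.
have -> : (fun k => picard k.+1 t i j) = (fun k => F t i j +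
    Rintegral mu `[0, t] (fun s => (M s *m picard k s) i j)).
  by apply/funext => k; rewrite /= mxE [in X in _ + X]mxE.
rewrite -[x0 i j + _]/(_ ).
have -> : x0 i j + Rintegral mu `[0, t] (fun s => g s i j) = F t i j by rewrite !mxE.
apply: cvgD; first exact: cvg_cst.
apply: fine_cvg; rewrite fineK; last exact: integrable_fin_num.
apply: (@dominated_cvg _ _ _ mu `[0, t]%classic _ _ _ (cst (m.+1%:R * K * C)%:E)) => //.
- move=> k; apply/measurable_EFinP.
  apply: int_on_measurable.
  exact: (int_onS tT' (mxcont_integrable (mxcontM cM (@cP k)) i j)).
- move=> s /=; rewrite in_itv/= => /andP[s0 st]; apply: cvg_EFin; first exact: nearW.
  have sT : 0 <= s <= T by rewrite s0 (le_trans st).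
  rewrite /comp /=; under eq_fun do rewrite mxE; rewrite mxE.
  apply: cvg_big => [|l _]; first exact: add_continuous.
  apply: cvgM; first exact: cvg_cst.
  exact: picard_cvg.
- apply: (int_onS tT'); apply: cont_on_integrable; exact: cont_on_cst.
- move=> k s /=; rewrite in_itv/= => /andP[s0 st].
  have sT : 0 <= s <= T by rewrite s0 (le_trans st).
  rewrite lee_fin; apply: mulmx_entry_bound; [exact: ltW|exact: ltW|exact: HK|].
  exact: HC.
Qed.

(** The weight makes the iteration contract on all of [[0, T]] at once, which replaces a
    continuation argument over short intervals. *)
Lemma linear_ode_exists : exists X : R -> 'M[R]_(m, n),
  X 0 = x0 /\ mprim T X (fun t => M t *m X t + g t).
Proof.
have L0 : picard_lim 0 = x0.
  rewrite picard_limE ?lexx ?ltW// /F; apply/matrixP => i j.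
  by rewrite !mxE set_itv1 !Rintegral_set1 !addr0.
exists picard_lim; split=> //.
have iML := mxintegrable_contM cM lim_int.
have iH := mxintegrableD iML ig.
move=> i j; split; first exact: (iH i j).
move=> t /[dup] tT /andP[t0 tT']; rewrite L0 picard_limE// !mxE.
have -> : Rintegral mu `[0, t] (fun s => (M s *m picard_lim s + g s) i j) =
  Rintegral mu `[0, t] (fun s => (M s *m picard_lim s) i j + g s i j).
  by apply: (eq_Rint_on tT') => s _; rewrite mxE.
rewrite RintegralD//; [ring|exact: (int_onS tT' (iML i j))|exact: (int_onS tT' (ig i j))].
Qed.

End Picard.

End LinearODE.
(** * The Riccati equation *)

Section Dot.
Variable R : realType.
Implicit Types n m : nat.

Lemma sqnE n (v : 'cV[R]_n) : sqn v = \sum_i v i 0 ^+ 2.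
Proof. by rewrite /sqn mxE; apply: eq_bigr => i _; rewrite mxE expr2. Qed.

Lemma sqn_ge0 n (v : 'cV[R]_n) : 0 <= sqn v.
Proof. by rewrite sqnE sumr_ge0// => i _; exact: sqr_ge0. Qed.

Lemma sqn_eq0 n (v : 'cV[R]_n) : sqn v = 0 -> v = 0.
Proof.
rewrite sqnE => v0; apply/matrixP => i j; rewrite ord1 mxE.
have /eqP := psumr_eq0P (fun i _ => sqr_ge0 (v i 0)) v0 (i := i) isT.
by rewrite sqrf_eq0 => /eqP.
Qed.

(** [kermx] is a left kernel, hence the passage through the transpose. *)
Lemma unitmx_ker0 (F : fieldType) n (B : 'M[F]_n) :
  (forall v : 'cV[F]_n, B *m v = 0 -> v = 0) -> B \in unitmx.
Proof.
move=> B0; rewrite -unitmx_tr -row_free_unit -kermx_eq0; apply/rowV0P => v.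
move=> /sub_kermxP vB; rewrite -[v]trmxK (B0 v^T) ?trmx0//.
by rewrite -[B]trmxK -trmx_mul vB trmx0.
Qed.

End Dot.

(** * Continuity of determinants, inverses and block matrices *)

Section Continuity.
Variables (R : realType) (T : R).
Notation mcont F := (mxcont_on T F).

Lemma cont_on_prod (I : Type) (s : seq I) (f : I -> R -> R) :
  (forall i, cont_on T (f i)) -> cont_on T (fun t => \prod_(i <- s) f i t).
Proof.
move=> fi; elim: s => [|i s IH].
  by apply: (cont_on_eq _ (@cont_on_cst _ _ 1)) => t _; rewrite big_nil.
by apply: (cont_on_eq _ (cont_onM (fi i) IH)) => t _; rewrite big_cons.
Qed.

Lemma cont_onV (f : R -> R) : cont_on T f -> (forall t : R, 0 <= t <= T -> f t != 0) ->
  cont_on T (fun t => (f t)^-1).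
Proof.
move=> cf f0; apply/subspace_continuousP => x /=; rewrite in_itv/= => xT.
apply: cvgV; first exact: f0.
by move/subspace_continuousP : cf; apply; rewrite /= in_itv.
Qed.

Lemma cont_on_det n (F : R -> 'M[R]_n) : mcont F -> cont_on T (fun t => \det (F t)).
Proof.
move=> cF; rewrite /determinant; apply: cont_on_sum => s _; apply: cont_onM.
  exact: cont_on_cst.
by apply: cont_on_prod => i; exact: cF.
Qed.

(** Cramer's formula: the inverse is the adjugate over a determinant that does not vanish, both
    polynomial in the entries. *)
Lemma mxcont_invmx n (F : R -> 'M[R]_n) : mcont F ->
  (forall t : R, 0 <= t <= T -> F t \in unitmx) -> mcont (fun t => invmx (F t)).
Proof.
move=> cF uF.
have H : mcont (fun t => (\det (F t))^-1 *: \adj (F t)).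
  move=> i j; have c1 : cont_on T (fun t => (\det (F t))^-1).
    apply: cont_onV; first exact: cont_on_det.
    by move=> t tT; have := uF t tT; rewrite unitmxE unitfE.
  have c2 : cont_on T (fun t => (\adj (F t)) i j).
    have c3 : cont_on T (fun t => cofactor (F t) j i).
      apply: cont_onM; first exact: cont_on_cst.
      apply: cont_on_det => k l.
      by apply: (cont_on_eq _ (cF (lift j k) (lift i l))) => t _; rewrite !mxE.
    by apply: (cont_on_eq _ c3) => t _; rewrite !mxE.
  by apply: (cont_on_eq _ (cont_onM c1 c2)) => t _; rewrite [RHS]mxE.
by apply: mxcont_eq H => t tT; rewrite /invmx uF.
Qed.

Lemma mxcont_col_mx m1 m2 n (F : R -> 'M[R]_(m1, n)) (G : R -> 'M[R]_(m2, n)) :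
  mcont F -> mcont G -> mcont (fun t => col_mx (F t) (G t)).
Proof.
move=> cF cG i j; case: (split_ordP i) => k ->.
  by apply: (cont_on_eq _ (cF k j)) => t _; rewrite col_mxEu.
by apply: (cont_on_eq _ (cG k j)) => t _; rewrite col_mxEd.
Qed.

Lemma mxcont_row_mx m n1 n2 (F : R -> 'M[R]_(m, n1)) (G : R -> 'M[R]_(m, n2)) :
  mcont F -> mcont G -> mcont (fun t => row_mx (F t) (G t)).
Proof.
move=> cF cG i j; case: (split_ordP j) => k ->.
  by apply: (cont_on_eq _ (cF i k)) => t _; rewrite row_mxEl.
by apply: (cont_on_eq _ (cG i k)) => t _; rewrite row_mxEr.
Qed.

End Continuity.

(** * Global existence and symmetry of the Riccati solution *)

Section Riccati.
Variables (R : realType) (T : R) (d d' : nat).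
Hypothesis T0 : 0 < T.
Notation mu := (@lebesgue_measure R).
Notation mint F := (mxintegrable (`[0, T]%classic : set R) F).
Notation mcont F := (mxcont_on T F).
Variables (Cm : 'M[R]_(d', d)) (A : R -> 'M[R]_d) (lam : R) (Q : 'M[R]_d).
Hypotheses (lam0 : 0 < lam) (cA : mcont A) (Qpos : sym_pos_def Q).

Definition riccati (t : R) (E : 'M[R]_d) : 'M[R]_d :=
  Cm^T *m Cm - (A t)^T *m E - E *m A t - lam^-1 *: (E *m E).

Lemma prim_ge (F f : R -> R) t : primitive_on T F f ->
  (forall s : R, 0 <= s <= T -> 0 <= f s) -> 0 <= t <= T -> F 0 <= F t.
Proof.
move=> Ff f0 /[dup] tT /andP[t0 tT']; rewrite (Ff.2 t tT) lerDl Rintegral_ge0// => s /=.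
by rewrite in_itv/= => /andP[s0 st]; apply: f0; rewrite s0 (le_trans st).
Qed.

Lemma mprimMr m n p (F f : R -> 'M[R]_(m, n)) (K : 'M[R]_(n, p)) :
  mprim T F f -> mprim T (fun t => F t *m K) (fun t => f t *m K).
Proof.
move=> Ff; apply: (mprim_eq T0 _ _ (mprimM T0 Ff (mprim_cst T0 K))) => t _ //.
by rewrite mulmx0 addr0.
Qed.

Section Hamiltonian.
Variables (Y P : R -> 'M[R]_d).
Hypotheses (HY : mprim T Y (fun t => A t *m Y t + lam^-1 *: P t))
  (HP : mprim T P (fun t => Cm^T *m Cm *m Y t - (A t)^T *m P t))
  (Y0 : Y 0 = 1%:M) (P0 : P 0 = Q).

(** With [y = Y v] and [p = P v], the product [y^T p] starts at [v^T Q v] and has the nonnegative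
    derivative [|p|^2 / lam + |Cm y|^2]. *)
Lemma hamiltonian_ge (t : R) (v : 'cV[R]_d) : 0 <= t <= T ->
  qform Q v <= ((Y t *m v)^T *m (P t *m v)) 0 0.
Proof.
move=> tT.
have Hy := mprimMr v HY; have Hp := mprimMr v HP.
have H := mprimM T0 (mprimT T0 Hy) Hp.
have := prim_ge (H 0 0) _ tT; rewrite Y0 P0 mul1mx mulmxA; apply => s sT.
set y := Y s *m v; set p := P s *m v.
have -> : (A s *m Y s + lam^-1 *: P s) *m v = A s *m y + lam^-1 *: p.
  by rewrite mulmxDl -mulmxA -scalemxAl.
have -> : (Cm^T *m Cm *m Y s - (A s)^T *m P s) *m v = Cm^T *m (Cm *m y) - (A s)^T *m p.
  by rewrite mulmxBl -!mulmxA.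
(* The term [y^T A^T p] appears with both signs and cancels. *)
have -> : (A s *m y + lam^-1 *: p)^T *m p + y^T *m (Cm^T *m (Cm *m y) - (A s)^T *m p) =
    lam^-1 *: (p^T *m p) + (Cm *m y)^T *m (Cm *m y).
  rewrite linearD/= linearZ/= mulmxDl mulmxBr -scalemxAl !trmx_mul !mulmxA.
  by rewrite [X in X + _ = _]addrC addrACA subrr addr0.
rewrite 2!mxE.
by rewrite addr_ge0 ?sqn_ge0// mulr_ge0 ?sqn_ge0// invr_ge0 ltW.
Qed.

(** If [Y t *m v = 0], the inequality gives [qform Q v <= 0], which forces [v = 0]. *)
Lemma hamiltonian_unit (t : R) : 0 <= t <= T -> Y t \in unitmx.
Proof.
move=> tT; apply: unitmx_ker0 => v Yv.
have := hamiltonian_ge v tT; rewrite Yv trmx0 mul0mx mxE.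
by case: (eqVneq v 0) => // /(proj2 Qpos); rewrite ltNge => /negbTE ->.
Qed.

End Hamiltonian.

(** Stacking [Y] over [P] gives a single linear equation with a continuous block coefficient. *)
Lemma hamiltonian_exists : exists Y P : R -> 'M[R]_d,
  [/\ Y 0 = 1%:M, P 0 = Q, mprim T Y (fun t => A t *m Y t + lam^-1 *: P t) &
  mprim T P (fun t => Cm^T *m Cm *m Y t - (A t)^T *m P t)].
Proof.
pose M t := block_mx (A t) (lam^-1%:M) (Cm^T *m Cm) (- (A t)^T).
have cM : mcont M.
  apply: mxcont_col_mx; apply: mxcont_row_mx => //; try exact: mxcont_cst.
  exact: mxcontN (mxcontT cA).
have i0 : mint (fun=> 0 : 'M[R]_(d + d, d)) by exact: mxcont_integrable (@mxcont_cst _ _ _ _ _).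
have [Z [Z0 HZ]] := linear_ode_exists T0 (col_mx 1%:M Q) cM i0.
have HM t : M t *m Z t + 0 = col_mx (A t *m usubmx (Z t) + lam^-1 *: dsubmx (Z t))
    (Cm^T *m Cm *m usubmx (Z t) - (A t)^T *m dsubmx (Z t)).
  by rewrite addr0 -{1}[Z t]vsubmxK mul_block_col mul_scalar_mx mulNmx.
exists (fun t => usubmx (Z t)), (fun t => dsubmx (Z t)); split.
- by rewrite Z0 col_mxKu.
- by rewrite Z0 col_mxKd.
- move=> i j; apply: (prim_eq T0 _ _ (HZ (lshift d i) j)) => t _; first by rewrite mxE.
  by rewrite HM col_mxEu.
- move=> i j; apply: (prim_eq T0 _ _ (HZ (rshift d i) j)) => t _; first by rewrite mxE.
  by rewrite HM col_mxEd.
Qed.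

(** To differentiate [P Y^-1] without a rule for inverses, [Y^-1] is obtained as the solution [N] of
    [N' = - N (A + E / lam)], where [E = P Y^-1] serves first as a continuous coefficient only. *)
Lemma riccati_exists : exists E, ivp_sol T Q riccati E.
Proof.
have [Y [P [Y0 P0 HY HP]]] := hamiltonian_exists.
have uY := hamiltonian_unit HY HP Y0 P0.
pose E t := P t *m invmx (Y t).
have cY := mprim_cont T0 HY.
have cE : mcont E := mxcontM (mprim_cont T0 HP) (mxcont_invmx cY uY).
have cK : mcont (fun t => - (A t + lam^-1 *: E t)^T).
  exact: mxcontN (mxcontT (mxcontD cA (mxcontZ cE))).
have i0 : mint (fun=> 0 : 'M[R]_d) by exact: mxcont_integrable (@mxcont_cst _ _ _ _ _).
(* [linear_ode_exists] has its coefficient on the left, so the transpose of [N] is solved for. *)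
have [N' [N0 HN']] := linear_ode_exists T0 1%:M cK i0.
pose N t := (N' t)^T.
have HN : mprim T N (fun t => - (N t *m (A t + lam^-1 *: E t))).
  apply: (mprim_eq T0 _ _ (mprimT T0 HN')) => t _ //.
  by rewrite addr0 mulNmx linearN/= trmx_mul trmxK.
have EY t : 0 <= t <= T -> E t *m Y t = P t.
  by move=> tT; rewrite /E mulmxKV// uY.
(* [N Y] has zero derivative because [E Y = P], and it starts at the identity. *)
have NY t : 0 <= t <= T -> N t *m Y t = 1%:M.
  move=> tT; rewrite (mprim_const T0 (mprimM T0 HN HY) _ tT) ?Y0 ?mulmx1.
    by rewrite /N N0 trmx1.
  move=> s sT; rewrite mulNmx -mulmxA mulmxDl -scalemxAl EY//.
  by rewrite addNr.
(* On [[0, T]] this witness equals [E], and in this form the product rule differentiates it. *)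
exists (fun t => P t *m N t); apply/(ivp_solP T0); split.
  by rewrite P0 /N N0 trmx1 mulmx1.
apply: (mprim_eq T0 _ _ (mprimM T0 HP HN)) => // t tT.
have NE : invmx (Y t) = N t.
  by rewrite -[LHS]mul1mx -(NY t tT) mulmxK// uY.
have YN : Y t *m N t = 1%:M by rewrite -NE mulmxV// uY.
have EE : E t = P t *m N t by rewrite /E NE.
rewrite -EE /riccati.
have -> : (Cm^T *m Cm *m Y t - (A t)^T *m P t) *m N t = Cm^T *m Cm - (A t)^T *m E t.
  by rewrite mulmxBl -[_ *m Y t *m _]mulmxA YN mulmx1 EE mulmxA.
by rewrite mulmxN (mulmxA (P t)) -EE mulmxDr -scalemxAr opprD addrA.
Qed.

Lemma riccati_cont E : ivp_sol T Q riccati E -> mcont E.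
Proof. by move=> /(ivp_solP T0)[_]; exact: mprim_cont. Qed.

(** [D = E - E^T] solves [D' = - (A^T + E / lam) D - D (A + E^T / lam)] with [D 0 = 0], since
    [E E - E^T E^T = E D + D E^T]. *)
Lemma riccati_sym E : ivp_sol T Q riccati E -> forall t : R, 0 <= t <= T -> (E t)^T = E t.
Proof.
move=> /[dup] /riccati_cont cE /(ivp_solP T0)[E0 HE] t tT.
apply/eqP; rewrite -subr_eq0 -oppr_eq0 opprB; apply/eqP.
have HD := mprimB T0 HE (mprimT T0 HE).
apply: (linear_ode_eq0 T0 (M1 := fun t => - ((A t)^T + lam^-1 *: E t))
  (M2 := fun t => - (A t + lam^-1 *: (E t)^T)) _ _ HD _ _ tT).
- exact: mxcontN (mxcontD (mxcontT cA) (mxcontZ cE)).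
- exact: mxcontN (mxcontD cA (mxcontZ (mxcontT cE))).
- move=> s _.
  have -> : (riccati s (E s))^T = Cm^T *m Cm - (E s)^T *m A s - (A s)^T *m (E s)^T -
      lam^-1 *: ((E s)^T *m (E s)^T).
    rewrite /riccati; set X := lam^-1 *: _.
    rewrite 3!(raddfB (@trmx R d d)) /= /X linearZ/= !trmx_mul !trmxK.
    by [].
  rewrite /riccati !(mulmxDl, mulmxDr, mulmxN, mulNmx) -!scalemxAl.
  move: (Cm^T *m Cm) ((A s)^T *m E s) ((A s)^T *m (E s)^T) => a b b'.
  move: (E s *m A s) ((E s)^T *m A s) => c c'.
  rewrite -!scalemxAr.
  move: (E s *m E s) ((E s)^T *m (E s)^T) (E s *m (E s)^T) => e e' e''.
  apply/matrixP => i j; rewrite !mxE; ring.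
- by rewrite E0 Qpos.1 subrr.
Qed.

End Riccati.
(** * Square-integrable controls and the cost identity *)

Section SquareIntegrable.
Variables (R : realType) (T : R).
Hypothesis T0 : 0 < T.
Notation mu := (@lebesgue_measure R).
Notation mint F := (mxintegrable (`[0, T]%classic : set R) F).
Notation mcont F := (mxcont_on T F).

Lemma measurable_sqn n (u : R -> 'cV[R]_n) :
  (forall i, measurable_fun `[0, T] (fun t => u t i 0)) ->
  measurable_fun `[0, T] (fun t => sqn (u t)).
Proof.
move=> um.
have -> : (fun t => sqn (u t)) = (fun t => \sum_i u t i 0 * u t i 0).
  by apply/funext => t; rewrite sqnE; apply: eq_bigr => i _; rewrite expr2.
by apply: measurable_sum => i; apply: measurable_funM.
Qed.

Lemma L2P n (u : R -> 'cV[R]_n) : L2 T u <->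
  (forall i, measurable_fun `[0, T] (fun t => u t i 0)) /\ int_on T (fun t => sqn (u t)).
Proof.
have E : (\int[mu]_(t in `[0%R, T]) (sqn (u t))%:E =
    \int[mu]_(t in `[0%R, T]) `|(sqn (u t))%:E|)%E.
  by apply: eq_integral => t _; rewrite gee0_abs// lee_fin sqn_ge0.
split=> -[m H]; split=> //.
  apply/integrableP; split; first by apply/measurable_EFinP; exact: measurable_sqn.
  by rewrite /= -E.
by rewrite E; have /integrableP[] := H.
Qed.

(** Domination of each entry by [1 + |u|^2], integrable on a bounded interval. *)
Lemma L2_integrable n (u : R -> 'cV[R]_n) : L2 T u -> mint u.
Proof.
move=> /L2P[m H] i j; rewrite (ord1 j).
have H1 : int_on T (fun t => 1 + sqn (u t)).
  by apply: int_onD => //; exact: cont_on_integrable (@cont_on_cst _ _ 1).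
apply: (le_integrable _ _ _ H1) => //; first by apply/measurable_EFinP; exact: m.
move=> t _; rewrite /= lee_fin [leRHS]ger0_norm ?addr_ge0 ?sqn_ge0//.
have h : u t i 0 ^+ 2 <= sqn (u t).
  by rewrite sqnE (bigD1 i)//= lerDl sumr_ge0// => k _; exact: sqr_ge0.
apply: le_trans (lerD (lexx 1) h).
rewrite ler_norml; apply/andP; split.
  by have := sqr_ge0 (u t i 0 + 1); have := sqr_ge0 (u t i 0); nra.
by have := sqr_ge0 (u t i 0 - 1); have := sqr_ge0 (u t i 0); nra.
Qed.

Lemma cont_dot n (u v : R -> 'cV[R]_n) : mcont u -> mcont v ->
  cont_on T (fun t => ((u t)^T *m v t) 0 0).
Proof. by move=> cu cv; have H := mxcontM (mxcontT cu) cv; exact: (H 0 0). Qed.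

Lemma cont_sqn n (u : R -> 'cV[R]_n) : mcont u -> cont_on T (fun t => sqn (u t)).
Proof. by move=> cu; exact: (cont_dot cu cu). Qed.

Lemma cont_L2 n (u : R -> 'cV[R]_n) : mcont u -> L2 T u.
Proof.
move=> cu; apply/L2P; split.
  by move=> i; exact: int_on_measurable (mxcont_integrable cu i 0).
exact: (cont_on_integrable (cont_sqn cu)).
Qed.

(** Domination by [2 |u|^2 + 2 |v|^2]. *)
Lemma L2B n (u v : R -> 'cV[R]_n) : L2 T u -> L2 T v -> L2 T (fun t => u t - v t).
Proof.
move=> /L2P[m H] /L2P[m' H']; apply/L2P.
have mB i : measurable_fun `[0, T] (fun t => (u t - v t) i 0).
  have -> : (fun t => (u t - v t) i 0) = (fun t => u t i 0 - v t i 0).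
    by apply/funext => t; rewrite !mxE.
  exact: measurable_funB.
split=> //.
have H1 := int_onD (int_onZ 2 H) (int_onZ 2 H').
apply: (le_integrable _ _ _ H1) => //; first by apply/measurable_EFinP; exact: measurable_sqn.
move=> t _; rewrite /= lee_fin !ger0_norm ?addr_ge0 ?mulr_ge0 ?sqn_ge0//.
rewrite !sqnE !mulr_sumr -big_split/=; apply: ler_sum => i _; rewrite !mxE.
by have := sqr_ge0 (u t i 0 + v t i 0); nra.
Qed.

Lemma Linf_L2 n (z : R -> 'cV[R]_n) : Linf T z -> L2 T z.
Proof.
move=> [m [M HM]]; split=> //.
apply: (@le_lt_trans _ _ (\int[mu]_(t in `[0%R, T]) (M ^+ 2)%:E)%E); last first.
  exact: integrable_lty (cont_on_integrable (@cont_on_cst _ T (M ^+ 2))).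
apply: ae_ge0_le_integral => //.
- by move=> t _; rewrite lee_fin sqn_ge0.
- by apply/measurable_EFinP; exact: measurable_sqn.
- by move=> t _; rewrite lee_fin sqr_ge0.
Qed.

Lemma int_on_ae_eq (f g : R -> R) t : int_on T f -> int_on T g -> 0 <= t <= T ->
  {ae mu, forall s, s \in `[0, T] -> f s = g s} ->
  Rintegral mu `[0, t] f = Rintegral mu `[0, t] g.
Proof.
move=> fi gi /andP[t0 tT] fg; congr fine; apply: ae_eq_integral => //.
- exact: measurable_int (int_onS tT fi).
- exact: measurable_int (int_onS tT gi).
- apply: (@filterS _ _ (ae_filter_ringOfSetsType mu) _ _ _ fg) => s H /=; rewrite in_itv/= => /andP[s0 st]; congr (_%:E); apply: H.
  by rewrite in_itv/= s0 (le_trans st).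
Qed.

(** Serves controls that agree with the feedback law only almost everywhere. *)
Lemma mprim_ae m n (F f g : R -> 'M[R]_(m, n)) : mprim T F f -> mint g ->
  {ae mu, forall s, s \in `[0, T] -> f s = g s} -> mprim T F g.
Proof.
move=> Ff gi fg i j; split; first exact: gi.
move=> t tT; rewrite (Ff i j).2//; congr (_ + _).
apply: int_on_ae_eq => //; [exact: (Ff i j).1|exact: gi|].
by apply: (@filterS _ _ (ae_filter_ringOfSetsType mu) _ _ _ fg) => s H /H ->.
Qed.

Lemma Rintegral_sqn_eq0 n (u : R -> 'cV[R]_n) : L2 T u ->
  Rintegral mu `[0, T] (fun t => sqn (u t)) = 0 ->
  {ae mu, forall t, t \in `[0, T] -> u t = 0}.
Proof.
move=> /L2P[m H] H0.
have I0 : (\int[mu]_(t in `[0%R, T]) `|(sqn (u t))%:E|)%E = 0.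
  have := congr1 EFin H0; rewrite /Rintegral fineK; last exact: integrable_fin_num.
  by move=> h; apply: etrans h; apply: eq_integral => t _; rewrite gee0_abs// lee_fin sqn_ge0.
have mT : measurable (`[0, T]%classic : set (measurableTypeR R)) by [].
have ms : measurable_fun `[0, T] (fun t => (sqn (u t))%:E).
  by apply/measurable_EFinP; exact: measurable_sqn.
have /= := (ae_eq_integral_abs mu mT ms).1 I0.
move=> fg; apply: (@filterS _ _ (ae_filter_ringOfSetsType mu) _ _ _ fg) => t H1 tT.
have [] := H1 tT; exact: sqn_eq0.
Qed.

Section Flow.
Variables (d : nat) (A : R -> 'M[R]_d) (r : R -> 'cV[R]_d).
Hypotheses (cA : mcont A) (cr : mcont r).

Lemma linear_ode_unique (g X1 X2 : R -> 'cV[R]_d) :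
  mprim T X1 (fun t => A t *m X1 t + g t) -> mprim T X2 (fun t => A t *m X2 t + g t) ->
  X1 0 = X2 0 -> forall t : R, 0 <= t <= T -> X1 t = X2 t.
Proof.
move=> H1 H2 X0 t tT; apply/eqP; rewrite -subr_eq0; apply/eqP.
apply: (linear_ode_eq0 T0 (M2 := fun=> 0) cA (@mxcont_cst _ _ _ _ _) (mprimB T0 H1 H2) _ _ tT).
  move=> s _; rewrite mulmx0 addr0 mulmxBr.
  by rewrite opprD addrACA subrr addr0.
by rewrite X0 subrr.
Qed.

(** [Xsol] is a choice among solutions, so its properties rest on the existence of one. *)
Lemma XsolP (u : R -> 'cV[R]_d) x0 : L2 T u ->
  Xsol T A r u x0 0 = x0 /\
  mprim T (Xsol T A r u x0) (fun t => A t *m Xsol T A r u x0 t + (r t + u t)).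
Proof.
move=> u2.
have gi : mint (fun t => r t + u t) := mxintegrableD (mxcont_integrable cr) (L2_integrable u2).
have [X [X0 HX]] := linear_ode_exists T0 x0 cA gi.
have Hex : ivp_sol T x0 (fun t x => A t *m x + r t + u t) X.
  apply/(ivp_solP T0); split=> //.
  by apply: (mprim_eq T0 _ _ HX) => t _ //; rewrite addrA.
have /(ivp_solP T0)[H0 H] := getPex (ex_intro _ X Hex : exists X, ivp_sol _ _ _ X).
split=> //; apply: (mprim_eq T0 _ _ H) => t _ //; by rewrite addrA.
Qed.

End Flow.

End SquareIntegrable.

(** * Algebra of completing squares *)

Section DotAlgebra.
Variable R : realType.

Definition dot n (a b : 'cV[R]_n) : R := (a^T *m b) 0 0.

Lemma dot_sym n (a b : 'cV[R]_n) : dot a b = dot b a.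
Proof. by rewrite /dot -[a in RHS]trmxK -trmx_mul [RHS]mxE. Qed.

Lemma dotDr n (a b c : 'cV[R]_n) : dot a (b + c) = dot a b + dot a c.
Proof. by rewrite /dot mulmxDr mxE. Qed.

Lemma dotZr n (k : R) (a b : 'cV[R]_n) : dot a (k *: b) = k * dot a b.
Proof. by rewrite /dot -scalemxAr mxE. Qed.

Lemma dotNr n (a b : 'cV[R]_n) : dot a (- b) = - dot a b.
Proof. by rewrite /dot mulmxN mxE. Qed.

Lemma dotDl n (a b c : 'cV[R]_n) : dot (b + c) a = dot b a + dot c a.
Proof. by rewrite !(dot_sym _ a) dotDr. Qed.

Lemma dotZl n (k : R) (a b : 'cV[R]_n) : dot (k *: b) a = k * dot b a.
Proof. by rewrite !(dot_sym _ a) dotZr. Qed.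

Lemma dotNl n (a b : 'cV[R]_n) : dot (- b) a = - dot b a.
Proof. by rewrite !(dot_sym _ a) dotNr. Qed.

Lemma dot_mulr n m (M : 'M[R]_(m, n)) (a : 'cV[R]_m) (b : 'cV[R]_n) :
  dot a (M *m b) = dot (M^T *m a) b.
Proof. by rewrite /dot trmx_mul trmxK mulmxA. Qed.

(* The left-hand side is the running cost minus the derivative of
   [x^T E x + 2 h^T x] along [x' = A x + r + u]. *)
Lemma running_cost_square d d' (Cm : 'M[R]_(d', d)) (A E : 'M[R]_d)
    (x h r u : 'cV[R]_d) (z : 'cV[R]_d') (lam : R) : lam != 0 -> E^T = E ->
  let x' := A *m x + (r + u) in
  let E' := Cm^T *m Cm - A^T *m E - E *m A - lam^-1 *: (E *m E) in
  let h' := - ((A^T + lam^-1 *: E) *m h) - (Cm^T *m z + E *m r) in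
  sqn (z - Cm *m x) + lam * sqn u
  - ((((x'^T *m E + x^T *m E') *m x + x^T *m E *m x') 0 0)
     + 2 * ((h'^T *m x + h^T *m x') 0 0)) =
  sqn z - 2 * (r^T *m h) 0 0 - lam^-1 * sqn h
  + lam * sqn (u - lam^-1 *: (E *m x + h)).
Proof.
move=> lam0 Es x' E' h'.
have -> : ((x'^T *m E + x^T *m E') *m x + x^T *m E *m x') 0 0 =
    2 * dot x' (E *m x) + dot x (E' *m x).
  rewrite mulmxDl [LHS]mxE [X in X + _]mxE -!mulmxA.
  rewrite -!/(dot _ _) (dot_mulr E x) Es (dot_sym _ x'); ring.
have -> : (h'^T *m x + h^T *m x') 0 0 = dot x h' + dot h x'.
  by rewrite mxE -!/(dot _ _) dot_sym.
have -> : (r^T *m h) 0 0 = dot r h by [].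
rewrite -![sqn _]/(dot _ _).
have -> : E' *m x = Cm^T *m (Cm *m x) - A^T *m (E *m x) - E *m (A *m x) - lam^-1 *: (E *m (E *m x)).
  by rewrite !mulmxBl -scalemxAl -!mulmxA.
have -> : h' = - (A^T *m h + lam^-1 *: (E *m h)) - (Cm^T *m z + E *m r).
  by rewrite /h' mulmxDl -scalemxAl.
(* After bilinear expansion, matrices paired with [x] are moved onto [x] and each symmetric pair
   gets one orientation, so that a scalar identity remains. *)
rewrite /x' !(dotDr, dotZr, dotNr, dotDl, dotZl, dotNl) !(dot_mulr _ x) !trmxK Es.
rewrite (dot_sym (A *m x) (E *m x)) (dot_sym (A *m x) h) (dot_sym (Cm *m x) z).
rewrite (dot_sym (E *m x) r) (dot_sym (E *m x) u) (dot_sym h (E *m x)) (dot_sym h r) (dot_sym h u).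
by field.
Qed.

(** Applied at time [T], this centres the boundary term at [- E^-1 h] and so reveals the optimal
    final state. *)
Lemma complete_square d (E : 'M[R]_d) (x h : 'cV[R]_d) : E \in unitmx -> E^T = E ->
  qform E x + 2 * dot h x =
  qform E (x + invmx E *m h) - qform (invmx E) h.
Proof.
move=> uE Es; have Ei : (invmx E)^T = invmx E by rewrite trmx_inv Es.
have q (M : 'M[R]_d) y : qform M y = dot y (M *m y) by rewrite /qform /dot mulmxA.
rewrite !q mulmxDr !(dotDr, dotZr, dotNr, dotDl, dotZl, dotNl) mulKVmx// (dot_mulr E (invmx E *m h) x) Es mulKVmx//.
rewrite (dot_sym (invmx E *m h)) (dot_sym x h); ring.
Qed.

End DotAlgebra.

(** * Adjoint equation, closed loop and cost identity *)

Section Tracking.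
Variables (R : realType) (T : R) (d d' : nat).
Hypothesis T0 : 0 < T.
Notation mu := (@lebesgue_measure R).
Notation mint F := (mxintegrable (`[0, T]%classic : set R) F).
Notation mcont F := (mxcont_on T F).
Variables (Cm : 'M[R]_(d', d)) (A : R -> 'M[R]_d) (r : R -> 'cV[R]_d)
  (z : R -> 'cV[R]_d') (lam : R) (Q : 'M[R]_d).
Hypotheses (lam0 : 0 < lam) (cA : mcont A) (cr : mcont r) (Qpos : sym_pos_def Q)
  (z2 : L2 T z).

Definition adjoint_rhs (E : R -> 'M[R]_d) t (h : 'cV[R]_d) : 'cV[R]_d :=
  - (((A t)^T + lam^-1 *: E t) *m h) - (Cm^T *m z t + E t *m r t).

(** Once [E] is known the equation is linear, with an integrable source because [z] is square
    integrable. *)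
Lemma adjoint_exists E : mcont E -> exists h, ivp_sol T 0 (adjoint_rhs E) h.
Proof.
move=> cE.
have cM : mcont (fun t => - ((A t)^T + lam^-1 *: E t)).
  exact: mxcontN (mxcontD (mxcontT cA) (mxcontZ cE)).
have ig : mint (fun t => - (Cm^T *m z t + E t *m r t)).
  apply: mxintegrableN; apply: mxintegrableD; last exact: mxcont_integrable (mxcontM cE cr).
  exact: (mxintegrable_contM (@mxcont_cst _ _ _ _ _) (L2_integrable z2)).
have [h [h0 Hh]] := linear_ode_exists T0 0 cM ig.
exists h; apply/(ivp_solP T0); split=> //.
by apply: (mprim_eq T0 _ _ Hh) => t _ //; rewrite mulNmx.
Qed.

Variables (E : R -> 'M[R]_d) (h : R -> 'cV[R]_d).
Hypotheses (HE : ivp_sol T Q (riccati Cm A lam) E) (Hh : ivp_sol T 0 (adjoint_rhs E) h).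

Let cE : mcont E. Proof. exact: riccati_cont HE. Qed.
Let Es : forall t : R, 0 <= t <= T -> (E t)^T = E t. Proof. exact: riccati_sym HE. Qed.
Let hP : h 0 = 0 /\ mprim T h (fun t => adjoint_rhs E t (h t)). Proof. exact/(ivp_solP T0). Qed.
Let ch : mcont h. Proof. exact: mprim_cont hP.2. Qed.
Let TT : 0 <= T <= T. Proof. by rewrite lexx ltW. Qed.

(** The state matrix once the feedback [(E x + h) / lam] replaces the control. *)
Let K t := A t + lam^-1 *: E t.
Let cK : mcont K. Proof. exact: mxcontD cA (mxcontZ cE). Qed.

(** For any given Riccati solution [E], the pair [(Y, E Y)] solves the Hamiltonian system;
    [hamiltonian_ge] at [v = Y^-1 w] then bounds [w^T E w] below by [v^T Q v > 0]. *)
Lemma closed_loop_exists : exists Y : R -> 'M[R]_d,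
  [/\ Y 0 = 1%:M, mprim T Y (fun t => K t *m Y t),
     (forall t : R, 0 <= t <= T -> Y t \in unitmx) &
     (forall (t : R) (w : 'cV[R]_d), 0 <= t <= T -> w != 0 -> 0 < qform (E t) w)].
Proof.
have i0 : mint (fun=> 0 : 'M[R]_d) by exact: mxcont_integrable (@mxcont_cst _ _ _ _ _).
have [Y [Y0 HY']] := linear_ode_exists T0 1%:M cK i0.
have HY : mprim T Y (fun t => K t *m Y t).
  by apply: (mprim_eq T0 _ _ HY') => t _ //; rewrite addr0.
have /(ivp_solP T0)[E0 HE'] := HE.
have HP : mprim T (fun t => E t *m Y t)
    (fun t => Cm^T *m Cm *m Y t - (A t)^T *m (E t *m Y t)).
  apply: (mprim_eq T0 _ _ (mprimM T0 HE' HY)) => t _ //.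
  rewrite /riccati /K !mulmxBl mulmxDl mulmxDr -!scalemxAl -!scalemxAr !mulmxA.
  by rewrite [X in _ + X]addrC addrA !subrK.
have HY2 : mprim T Y (fun t => A t *m Y t + lam^-1 *: (E t *m Y t)).
  by apply: (mprim_eq T0 _ _ HY) => t _ //; rewrite /K mulmxDl -scalemxAl.
have P0 : E 0 *m Y 0 = Q by rewrite E0 Y0 mulmx1.
have uY := hamiltonian_unit T0 lam0 Qpos HY2 HP Y0 P0.
exists Y; split=> // t w tT w0.
have := hamiltonian_ge T0 lam0 HY2 HP Y0 P0 (invmx (Y t) *m w) tT.
rewrite -(mulmxA (E t)) mulKVmx ?uY// mulmxA -/(qform _ _); apply: lt_le_trans.
apply: Qpos.2; apply: contra_neq w0 => v0.
by rewrite -[w](mulKVmx (uY t tT)) v0 mulmx0.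
Qed.

Lemma riccati_unit : E T \in unitmx.
Proof.
have [_ [_ _ _ pos]] := closed_loop_exists.
apply: unitmx_ker0 => v Ev; apply/eqP; apply: contraT => v0.
by have := pos T v TT v0; rewrite /qform -mulmxA Ev mulmx0 mxE ltxx.
Qed.

Notation S0 := (Rintegral mu `[0, T]
   (fun t => sqn (z t) - 2 * ((r t)^T *m h t) 0 0 - lam^-1 * sqn (h t))
   - qform (invmx (E T)) (h T)).
Notation X u x0 := (Xsol T A r u x0).

Lemma feedback_gap_L2 u x0 : L2 T u ->
  L2 T (fun t => u t - lam^-1 *: (E t *m X u x0 t + h t)).
Proof.
move=> u2; have [_ HX] := XsolP T0 cA cr x0 u2.
have cX := mprim_cont T0 HX.
apply: L2B => //; apply: cont_L2.
exact: (mxcontZ (mxcontD (mxcontM cE cX) ch)).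
Qed.

(** Integrates [running_cost_square] over [[0, T]] and applies [complete_square] to the boundary
    term at [T]. *)
Lemma costE u x0 : L2 T u ->
  cost T Cm Q A r lam z u x0 =
  (S0 + lam * Rintegral mu `[0, T] (fun t => sqn (u t - lam^-1 *: (E t *m X u x0 t + h t)))
    + qform (E T) (X u x0 T + invmx (E T) *m h T))%:E.
Proof.
move=> u2; have [X0 HX] := XsolP T0 cA cr x0 u2.
have /(ivp_solP T0)[E0 HE'] := HE; have [h0 Hh'] := hP.
set x := X u x0 in X0 HX *.
(* The product rule presents [x^T E x + 2 h^T x] as a primitive; [v] names its derivative. *)
have V1 := mprimM T0 (mprimM T0 (mprimT T0 HX) HE') HX.
have V2 := mprimM T0 (mprimT T0 Hh') HX.
have V := primD (V1 0 0) (primZ 2 (V2 0 0)).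
set v := (v in primitive_on _ _ v) in V.
have i1 : int_on T (fun t => sqn (z t) - 2 * ((r t)^T *m h t) 0 0 - lam^-1 * sqn (h t)).
  apply: int_onB; first apply: int_onB.
  - by have /L2P[] := z2.
  - by apply: int_onZ; apply: cont_on_integrable; exact: cont_dot.
  - by apply: int_onZ; apply: cont_on_integrable; exact: cont_sqn.
have i2 : int_on T (fun t => lam * sqn (u t - lam^-1 *: (E t *m x t + h t))).
  by apply: int_onZ; have /L2P[] := feedback_gap_L2 x0 u2.
have i12 := int_onD i1 i2.
have idt t : 0 <= t <= T -> v t + ((sqn (z t) - 2 * ((r t)^T *m h t) 0 0 - lam^-1 * sqn (h t)) +
    lam * sqn (u t - lam^-1 *: (E t *m x t + h t))) =
    sqn (z t - Cm *m x t) + lam * sqn (u t).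
  move=> tT; rewrite -(running_cost_square Cm (A t) _ _ _ _ _ (lt0r_neq0 lam0) (Es tT)).
  exact: etrans (addrC _ _) (subrK _ _).
(* The cost integrand is integrable, so the extended real integral is a real number. *)
have i3 := int_on_eq idt (int_onD V.1 i12).
rewrite /cost -/x -[(\int[mu]_(t in _) _)%E]fineK; last exact: integrable_fin_num.
rewrite -EFinD; congr (_%:E).
rewrite -/(Rintegral mu _ _) -(eq_Rint_on (lexx T) idt) (RintegralD _ V.1 i12)// (RintegralD _ i1 i2)// RintegralZl//; last first.
  by have /L2P[] := feedback_gap_L2 x0 u2.
(* At time 0 the part in [h] vanishes and [E 0 = Q], which leaves [qform Q x0]. *)
have := V.2 T TT.
have -> : ((x T)^T *m E T *m x T) 0 0 = qform (E T) (x T) by [].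
have -> : ((x 0)^T *m E 0 *m x 0) 0 0 = qform Q x0 by rewrite X0 E0.
have -> : ((h 0)^T *m x 0) 0 0 = 0 by rewrite h0 trmx0 mul0mx mxE.
rewrite mulr0 addr0 => H.
have := complete_square (x T) (h T) riccati_unit (Es TT).
rewrite -[dot _ _]/(((h T)^T *m x T) 0 0) H => H2.
set a := Rintegral mu `[0, T] v in H2 *.
have -> : qform (E T) (x T + invmx (E T) *m h T) = qform Q x0 + a + qform (invmx (E T)) (h T).
  by rewrite H2 subrK.
ring.
Qed.

End Tracking.

(** * Construction and uniqueness of the optimal pair *)

Section Optimum.
Variables (R : realType) (T : R) (d d' : nat).
Hypothesis T0 : 0 < T.
Notation mu := (@lebesgue_measure R).
Notation mcont F := (mxcont_on T F).
Variables (Cm : 'M[R]_(d', d)) (A : R -> 'M[R]_d) (r : R -> 'cV[R]_d)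
  (z : R -> 'cV[R]_d') (lam : R) (Q : 'M[R]_d).
Hypotheses (lam0 : 0 < lam) (cA : mcont A) (cr : mcont r) (Qpos : sym_pos_def Q)
  (z2 : L2 T z).
Variables (E : R -> 'M[R]_d) (h : R -> 'cV[R]_d).
Hypotheses (HE : ivp_sol T Q (riccati Cm A lam) E)
  (Hh : ivp_sol T 0 (adjoint_rhs Cm A r z lam E) h).
Notation S0 := (Rintegral mu `[0, T]
   (fun t => sqn (z t) - 2 * ((r t)^T *m h t) 0 0 - lam^-1 * sqn (h t))
   - qform (invmx (E T)) (h T)).
Notation X u x0 := (Xsol T A r u x0).
Notation J u x0 := (cost T Cm Q A r lam z u x0).
Notation gap u x0 := (Rintegral mu `[0, T]
  (fun t => sqn (u t - lam^-1 *: (E t *m X u x0 t + h t)))).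
Notation final u x0 := (X u x0 T + invmx (E T) *m h T).

Let TT : 0 <= T <= T. Proof. by rewrite lexx ltW. Qed.

Lemma mem0T_ae (P : R -> Prop) : (forall t : R, 0 <= t <= T -> P t) ->
  {ae mu, forall t, t \in `[0, T] -> P t}.
Proof. by move=> HP; apply: aeW => t; rewrite in_itv/=; exact: HP. Qed.

(** Closed-loop trajectories have the form [Y x0 + Xp] with [Y T] invertible, so the prescribed
    final state determines the initial one. *)
Lemma tracking_optimum : exists (ubar : R -> 'cV[R]_d) (x0hat : 'cV[R]_d),
  [/\ L2 T ubar,
    (forall t : R, 0 <= t <= T -> ubar t = lam^-1 *: (E t *m X ubar x0hat t + h t)),
    X ubar x0hat T = - (invmx (E T) *m h T) &
    (forall u x0, L2 T u ->
      {ae mu, forall t, t \in `[0, T] -> u t = lam^-1 *: (E t *m X u x0 t + h t)} ->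
      X u x0 T = - (invmx (E T) *m h T) ->
      x0 = x0hat /\ {ae mu, forall t, t \in `[0, T] -> u t = ubar t})].
Proof.
have cE : mcont E := riccati_cont T0 HE.
have /(ivp_solP T0)[h0 Hh'] := Hh.
have ch := mprim_cont T0 Hh'.
have [Y [Y0 HY uY _]] := closed_loop_exists T0 lam0 cA Qpos HE.
have cK : mcont (fun t => A t + lam^-1 *: E t) := mxcontD cA (mxcontZ cE).
have cg : mcont (fun t => r t + lam^-1 *: h t) := mxcontD cr (mxcontZ ch).
have [Xp [Xp0 HXp]] := linear_ode_exists T0 0 cK (mxcont_integrable cg).
(* Solves [Y T *m x0 + Xp T = - (invmx (E T) *m h T)] for [x0]. *)
pose x0hat : 'cV[R]_d := invmx (Y T) *m (- (invmx (E T) *m h T) - Xp T).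
pose Xh t := Y t *m x0hat + Xp t.
have HXh : mprim T Xh (fun t => (A t + lam^-1 *: E t) *m Xh t + (r t + lam^-1 *: h t)).
  apply: (mprim_eq T0 _ _ (mprimD T0 (mprimMr T0 x0hat HY) HXp)) => t _ //.
  by rewrite /Xh mulmxDr mulmxA addrA.
have XhT : Xh T = - (invmx (E T) *m h T).
  by rewrite /Xh mulKVmx ?uY// subrK.
pose ubar t := lam^-1 *: (E t *m Xh t + h t).
have ub2 : L2 T ubar.
  by apply: cont_L2; exact: (mxcontZ (mxcontD (mxcontM cE (mprim_cont T0 HXh)) ch)).
(* The closed-loop equation is the state equation driven by the feedback control. *)
have loop M e (a b c : 'cV[R]_d) : (M + lam^-1 *: e) *m a + (b + lam^-1 *: c) =
    M *m a + (b + lam^-1 *: (e *m a + c)).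
  by rewrite mulmxDl -scalemxAl scalerDr -!addrA; congr (_ + _); rewrite addrCA.
have [Xb0 HXb] := XsolP T0 cA cr x0hat ub2.
have XbE : forall t : R, 0 <= t <= T -> X ubar x0hat t = Xh t.
  apply: (linear_ode_unique T0 cA HXb); last first.
    by rewrite Xb0 /Xh Y0 Xp0 mul1mx addr0.
  by apply: (mprim_eq T0 _ _ HXh) => t _ //; rewrite loop.
exists ubar, x0hat; split=> //.
- by move=> t tT; rewrite XbE.
- by rewrite XbE.
move=> u x0 u2 uE XT; have [X0 HX] := XsolP T0 cA cr x0 u2.
(* The competing control obeys the feedback law only almost everywhere; [mprim_ae] still puts its
   trajectory on the closed loop. *)
have HX' : mprim T (X u x0) (fun t => (A t + lam^-1 *: E t) *m X u x0 t + (r t + lam^-1 *: h t)).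
  have cX := mprim_cont T0 HX.
  apply: (mprim_ae HX).
    exact: mxcont_integrable (mxcontD (mxcontM cK cX) cg).
  apply: (@filterS _ _ (ae_filter_ringOfSetsType mu) _ _ _ uE) => t H /H uEt.
  by rewrite loop -uEt.
have HXh2 : mprim T (fun t => Y t *m x0 + Xp t)
    (fun t => (A t + lam^-1 *: E t) *m (Y t *m x0 + Xp t) + (r t + lam^-1 *: h t)).
  apply: (mprim_eq T0 _ _ (mprimD T0 (mprimMr T0 x0 HY) HXp)) => t _ //.
  by rewrite mulmxDr mulmxA addrA.
have XE : forall t : R, 0 <= t <= T -> X u x0 t = Y t *m x0 + Xp t.
  by apply: (linear_ode_unique T0 cK HX' HXh2); rewrite X0 Y0 mul1mx Xp0 addr0.
have x0E : x0 = x0hat.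
  by rewrite /x0hat -XT XE// addrK mulKmx ?uY.
split=> //.
apply: (@filterS _ _ (ae_filter_ringOfSetsType mu) _ _ _ uE) => t H tT.
by rewrite (H tT) /ubar XE ?x0E//; move: tT; rewrite in_itv.
Qed.

Lemma gap_ge0 u x0 : 0 <= gap u x0.
Proof. by apply: Rintegral_ge0 => t _; exact: sqn_ge0. Qed.

(** The equality case is what lets a minimal cost pin down the final state. *)
Lemma final_ge0 (w : 'cV[R]_d) : 0 <= qform (E T) w ?= iff (w == 0).
Proof.
have [_ [_ _ _ pos]] := closed_loop_exists T0 lam0 cA Qpos HE.
have [->|w0] := eqVneq w 0; first by rewrite /qform mulmx0 mxE; exact/leif_refl.
by have q0 := pos T w TT w0; split; [exact: ltW|exact: lt_eqF].
Qed.

Lemma cost_lower_bound u x0 : L2 T u -> (S0%:E <= J u x0)%E.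
Proof.
move=> u2; rewrite (costE T0 lam0 cA cr Qpos z2 HE Hh x0 u2) lee_fin -addrA lerDl.
by rewrite addr_ge0 ?(final_ge0 _).1// mulr_ge0 ?gap_ge0 ?ltW.
Qed.

Lemma cost_attains u x0 : L2 T u ->
  {ae mu, forall t, t \in `[0, T] -> u t = lam^-1 *: (E t *m X u x0 t + h t)} ->
  X u x0 T = - (invmx (E T) *m h T) -> J u x0 = S0%:E.
Proof.
move=> u2 uE XT; rewrite (costE T0 lam0 cA cr Qpos z2 HE Hh x0 u2) XT addNr.
rewrite {2}/qform mulmx0 mxE addr0.
have /L2P[_ gi] := feedback_gap_L2 T0 cA cr HE Hh x0 u2.
rewrite (@int_on_ae_eq _ T _ (fun=> 0) T gi)//.
- by rewrite Rintegral_cst// mul0r mulr0 addr0.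
- exact: int_on0.
- apply: (@filterS _ _ (ae_filter_ringOfSetsType mu) _ _ _ uE) => t H /H uEt.
  by rewrite -uEt subrr /sqn mulmx0 mxE.
Qed.

(** The two nonnegative remainders in [costE] sum to zero, so each vanishes: the gap yields the
    feedback law, the quadratic form the final state. *)
Lemma cost_attains_inv u x0 : L2 T u -> J u x0 = S0%:E ->
  {ae mu, forall t, t \in `[0, T] -> u t = lam^-1 *: (E t *m X u x0 t + h t)} /\
  X u x0 T = - (invmx (E T) *m h T).
Proof.
move=> u2; rewrite (costE T0 lam0 cA cr Qpos z2 HE Hh x0 u2) => -[].
rewrite -addrA => /eqP; rewrite -subr_eq0 [W in W - _]addrC addrK.
have g0 : 0 <= lam * gap u x0 by rewrite mulr_ge0 ?gap_ge0 ?ltW.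
rewrite paddr_eq0 ?(final_ge0 _).1// mulf_eq0 (gt_eqF lam0)/= => /andP[/eqP g /eqP f].
split.
  have := Rintegral_sqn_eq0 (feedback_gap_L2 T0 cA cr HE Hh x0 u2) g.
  move=> H; apply: (@filterS _ _ (ae_filter_ringOfSetsType mu) _ _ _ H) => t Ht /Ht.
  by move/eqP; rewrite subr_eq0 => /eqP.
apply/eqP; rewrite -addr_eq0 -(final_ge0 _).2 f.
by [].
Qed.

End Optimum.

Theorem mainTheorem1 (R : realType) (T : R) (d d' p : nat)
  (Cm : 'M[R]_(d', d)) (Theta : set 'rV[R]_p)
  (A : 'rV[R]_p -> R -> 'M[R]_d) (r : 'rV[R]_p -> R -> 'cV[R]_d)
  (z : R -> 'cV[R]_d') (theta : 'rV[R]_p) (lam : R) (Q : 'M[R]_d) :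
  0 < T -> (0 < d)%N -> (0 < d')%N ->
  (forall th, Theta th -> mxcont_on T (A th) /\ mxcont_on T (r th)) ->
  Linf T z -> Theta theta -> 0 < lam -> sym_pos_def Q ->
  let At := A theta in
  let rt := r theta in
  (* Riccati right-hand side:  E' = C^T C - A^T E - E A - (1/lam) E^2 *)
  let Erhs := fun t (E : 'M[R]_d) =>
    Cm^T *m Cm - (At t)^T *m E - E *m At t - lam^-1 *: (E *m E) in
  (* h' = - alpha h - beta, alpha = A^T + E/lam, beta = C^T zeta + E r *)
  let hrhs := fun (E : R -> 'M[R]_d) t (h : 'cV[R]_d) =>
    - (((At t)^T + lam^-1 *: E t) *m h) - (Cm^T *m z t + E t *m rt t) in
  (exists (E : R -> 'M[R]_d) (h : R -> 'cV[R]_d),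
      ivp_sol T Q Erhs E /\ ivp_sol T 0 (hrhs E) h) /\
  forall (E : R -> 'M[R]_d) (h : R -> 'cV[R]_d),
    ivp_sol T Q Erhs E -> ivp_sol T 0 (hrhs E) h ->
    (forall t, 0 <= t <= T -> (E t)^T = E t) /\
    E T \in unitmx /\
    exists (ubar : R -> 'cV[R]_d) (x0hat : 'cV[R]_d),
      L2 T ubar /\
      (forall u x0, L2 T u ->
         (cost T Cm Q At rt lam z ubar x0hat <= cost T Cm Q At rt lam z u x0)%E) /\
      (forall u x0, L2 T u ->
         cost T Cm Q At rt lam z u x0 = cost T Cm Q At rt lam z ubar x0hat ->
         x0 = x0hat /\
         {ae (@lebesgue_measure R), forall t, t \in `[0, T] -> u t = ubar t}) /\
      {ae (@lebesgue_measure R), forall t, t \in `[0, T] ->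
         ubar t = lam^-1 *: (E t *m Xsol T At rt ubar x0hat t + h t)} /\
      profiled T Cm Q At rt lam z =
        (Rintegral (@lebesgue_measure R) `[0, T]
           (fun t => sqn (z t) - 2 * ((rt t)^T *m h t) 0 0 - lam^-1 * sqn (h t))
         - qform (invmx (E T)) (h T))%:E /\
      Xsol T At rt ubar x0hat T = - (invmx (E T) *m h T).
Proof.
move=> T0 _ _ Acont zinf thetaP lam0 Qpos At rt Erhs hrhs.
have [cA cr] := Acont _ thetaP; have z2 := Linf_L2 zinf.
split.
  have [E HE] := riccati_exists T0 Cm lam0 cA Qpos.
  have [h Hh] := adjoint_exists T0 Cm lam cA cr z2 (riccati_cont T0 HE).
  by exists E, h.
move=> E h HE Hh.
split; first exact: riccati_sym HE.
split; first exact: riccati_unit HE.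
have [ubar [x0hat [u2 uE XT uniq]]] := tracking_optimum T0 lam0 cA cr Qpos HE Hh.
have uae := mem0T_ae uE.
have Jbar := cost_attains T0 lam0 cA cr Qpos z2 HE Hh u2 uae XT.
have lb := cost_lower_bound T0 lam0 cA cr Qpos z2 HE Hh.
exists ubar, x0hat; split=> //; split.
  by move=> u x0 Hu; rewrite Jbar; exact: lb.
split.
  move=> u x0 Hu; rewrite Jbar => JE.
  (* Another minimizer also attains the closed form, hence meets the feedback and final-state
     conditions, which determine the pair. *)
  have [a b] := cost_attains_inv T0 lam0 cA cr Qpos z2 HE Hh Hu JE.
  exact: uniq.
split=> //; split=> //.
(* The optimal pair bounds the nested infimum from above; the lower bound valid for every pair
   bounds it from below. *)
apply/eqP; rewrite eq_le; apply/andP; split.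
  rewrite -Jbar; apply: (@le_trans _ _ (ereal_inf [set cost T Cm Q At rt lam z u x0hat | u in L2 T])).
    by apply: ereal_inf_lbound; exists x0hat.
  by apply: ereal_inf_lbound; exists ubar.
apply: le_ereal_inf_tmp => _ [x0 _ <-]; apply: le_ereal_inf_tmp => _ [u Hu <-].
exact: lb.
Qed.
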